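(* Let $\mathsf{S}_6=\langle d_1,\ldots,d_6\rangle$ be a symmetric numerical semigroup that is not a complete intersection, of embedding dimension $6$, with minimal generators $d_1<\cdots<d_6$, $\gcd(d_1,\ldots,d_6)=1$. Let $\beta_1,\beta_2$ be its first and second Betti numbers and let $g$ be the largest degree of its syzygies, so that its Hilbert series is $$H(\mathsf{S}_6;t)=\frac{1-\sum_{j=1}^{\beta_1}t^{x_j}+\sum_{j=1}^{\beta_2}t^{y_j}-\sum_{j=1}^{\beta_2}t^{g-y_j}+\sum_{j=1}^{\beta_1}t^{g-x_j}-t^{g}}{\prod_{i=1}^6(1-t^{d_i})}.$$ Put $$\pi_6=\prod_{j=1}^6 d_j,\qquad \mathcal{B}_6=\frac{\beta_2-\beta_1+1}{2},\qquad b=\frac{\mathcal{B}_6}{\beta_1},\qquad A_*=0.9682,\qquad \alpha=1-A_*^2,$$ $$G(b,u)=\frac{u}{u+b}(1-u)^2(1-2u)^2,$$ and let $u_m=u_m(b)\in(0,1/2)$ be the point at which $G(b,\cdot)$ attains its global maximum, namely the smaller positive root of $8u^3+2(5b-3)u^2-9bu+b=0$. Then $$g>g_6,\qquad g_6=\lambda_6\sqrt[5]{\pi_6},\qquad \lambda_6=\sqrt[5]{\frac{360}{\mathcal{B}_6\,K(b,A_* )}},\qquad K(b,A_* )=\alpha+A_*^2\,G(b,u_m).$$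
   Context: A numerical semigroup $\mathsf{S}=\langle d_1,\ldots,d_m\rangle$ is the additive submonoid of $\mathbb{Z}_{\ge 0}$ generated by positive integers $d_1,\ldots,d_m$ with $\gcd(d_1,\ldots,d_m)=1$; its embedding dimension is the number of elements of its minimal generating set. $F(\mathsf{S})$ denotes its Frobenius number, the largest integer not in $\mathsf{S}$. $\mathsf{S}$ is symmetric if for every integer $n$ exactly one of $n$, $F(\mathsf{S})-n$ lies in $\mathsf{S}$. Let $k$ be a field and let $k[z_1,\ldots,z_m]$ be graded by $\deg z_i=d_i$, where $d_1,\ldots,d_m$ are the minimal generators; the semigroup ring $k[\mathsf{S}]$ is the quotient of this polynomial ring by the kernel of $z_i\mapsto t^{d_i}$. The Betti numbers $\beta_0=1,\beta_1,\ldots,\beta_{m-1}$ are the ranks of the free modules in the minimal graded free resolution of $k[\mathsf{S}]$ over $k[z_1,\ldots,z_m]$. $\mathsf{S}$ is a complete intersection (CI) if the kernel ideal is minimally generated by $m-1$ elements, i.e. $\beta_1=m-1$. The Hilbert series is $H(\mathsf{S};t)=\sum_{s\in\mathsf{S}}t^s$. For symmetric $\mathsf{S}_6$ of embedding dimension $6$ the resolution is self-dual ($\beta_j=\beta_{5-j}$, $\beta_5=1$). In the displayed Hilbert series, $x_1,\ldots,x_{\beta_1}$ are the degrees of the first syzygies (the minimal generators of the kernel ideal), $y_1,\ldots,y_{\beta_2}$ are the degrees of the second syzygies, and $g$ is the degree of the last (fifth) syzygy, which is the largest degree. These are positive integers with $2d_1\le x_j,y_j<g$. One has $F(\mathsf{S}_6)=g-\sum_{j=1}^6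 d_j$. *)

(* Defs.v *)
From mathcomp Require Import all_boot all_order all_algebra.
From mathcomp Require Import mpoly.
From mathcomp Require Import reals exp.
Set Implicit Arguments.
Unset Strict Implicit.
Unset Printing Implicit Defensive.
Import Order.TTheory GRing.Theory Num.Theory.

Local Open Scope ring_scope.

Definition generated (m : nat) (d : 'I_m -> nat) (A : {set 'I_m}) (n : nat)
  : Prop :=
  exists a : 'I_m -> nat, n = (\sum_(i in A) a i * d i)%N.

(* Membership in S = <d_1, ..., d_m> is extended to all integers, since symmetry
   quantifies over them. *)
Definition in_semigroup (m : nat) (d : 'I_m -> nat) (n : int) : Prop :=
  exists2 s : nat, generated d [set: 'I_m] s & n = s%:Z.

(* d lists, in increasing order, the minimal generating set of a numerical
   semigroup, which therefore has embedding dimension m. *)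
Definition minimal_generators (m : nat) (d : 'I_m -> nat) : Prop :=
  [/\ forall i, (0 < d i)%N,
      forall i j : 'I_m, (i < j)%N -> (d i < d j)%N,
      \big[gcdn/0%N]_(i < m) d i = 1%N
    & forall A : {set 'I_m},
        (forall n, generated d A n <-> generated d [set: 'I_m] n) ->
        A = [set: 'I_m]].

Definition is_Frobenius_number (m : nat) (d : 'I_m -> nat) (F : int) : Prop :=
  ~ in_semigroup d F /\ forall n : int, F < n -> in_semigroup d n.

Definition symmetric_semigroup (m : nat) (d : 'I_m -> nat) : Prop :=
  exists2 F : int, is_Frobenius_number d F &
    forall n : int,
      (in_semigroup d n /\ ~ in_semigroup d (F - n)) \/
      (~ in_semigroup d n /\ in_semigroup d (F - n)).

(* The kernel of k[z_1, ..., z_m] -> k[t], z_i |-> t^(d_i), so that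
   k[S] = k[z_1, ..., z_m] / toric_ideal. *)
Definition toric_ideal (k : fieldType) (m : nat) (d : 'I_m -> nat)
    (p : {mpoly k[m]}) : Prop :=
  mmap (@polyC k) (fun i => 'X^(d i)) p = 0 :> {poly k}.

Definition wdeg (m : nat) (d : 'I_m -> nat) (mu : 'X_{1..m}) : nat :=
  (\sum_(i < m) mu i * d i)%N.

(* A sequence ... -> F_2 -> F_1 -> F_0 of finite free modules: F_i has rank
   [betti i] and its j-th basis element has degree [twist j]. Elements of F_i
   are row vectors and F_(i+1) -> F_i is v |-> v *m differential i. *)
Record free_sequence (k : fieldType) (m : nat) := FreeSequence {
  betti : nat -> nat;
  twist : forall i : nat, 'I_(betti i) -> nat;
  differential : forall i : nat, 'M[{mpoly k[m]}]_(betti i.+1, betti i)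
}.

(* No bound on the length is imposed: that F_i = 0 for i >= m is a consequence,
   not part of the definition. *)
Definition is_minimal_graded_resolution (k : fieldType) (m : nat)
    (d : 'I_m -> nat) (C : free_sequence k m) : Prop :=
  [/\ (* F_0 = k[z_1, ..., z_m], generated in degree 0 *)
      betti C 0 = 1%N /\ (forall j : 'I_(betti C 0), twist j = 0%N),
      (* the differentials are homogeneous of degree 0 *)
      forall i (r : 'I_(betti C i.+1)) (c : 'I_(betti C i)) (mu : 'X_{1..m}),
        mu \in msupp (differential C i r c) ->
        (wdeg d mu + twist c)%N = twist r,
      (* F_1 -> F_0 -> k[S] -> 0 is exact *)
      forall v : 'rV[{mpoly k[m]}]_(betti C 0),
        (exists w, v = w *m differential C 0) <->
        (forall j, toric_ideal d (v 0 j)),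
      (* F_(i+2) -> F_(i+1) -> F_i is exact *)
      forall i (v : 'rV[{mpoly k[m]}]_(betti C i.+1)),
        (exists w, v = w *m differential C i.+1) <->
        v *m differential C i = 0
    & (* minimality: all entries lie in the ideal (z_1, ..., z_m) *)
      forall i (r : 'I_(betti C i.+1)) (c : 'I_(betti C i)),
        (differential C i r c)@_(0%MM) = 0].

(* For C a minimal graded free resolution of k[S], betti C 1 is the minimal
   number of generators of the toric ideal. *)
Definition complete_intersection (k : fieldType) (m : nat)
    (C : free_sequence k m) : Prop :=
  betti C 1 = m.-1.

(* The degrees of the i-th syzygies, i >= 1, are the values of [twist] on F_i. *)
Definition is_largest_syzygy_degree (k : fieldType) (m : nat)
    (C : free_sequence k m) (g : nat) : Prop :=
  (exists (i : nat) (j : 'I_(betti C i.+1)), twist j = g) /\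
  (forall (i : nat) (j : 'I_(betti C i.+1)), (twist j <= g)%N).

Definition G (R : realType) (b u : R) : R :=
  u / (u + b) * (1 - u) ^+ 2 * (1 - 2 * u) ^+ 2.

Definition cubic (R : realType) (b u : R) : R :=
  8 * u ^+ 3 + 2 * (5 * b - 3) * u ^+ 2 - 9 * b * u + b.

(* The strict inequality makes the maximizer over (0, 1/2) unique. *)
Definition is_the_maximizer (R : realType) (f : R -> R) (u : R) : Prop :=
  0 < u < 1 / 2 /\ forall v, 0 < v < 1 / 2 -> v != u -> f v < f u.

(* "Smaller" presupposes exactly two positive roots, u and w. *)
Definition is_smaller_positive_root (R : realType) (f : R -> R) (u : R)
  : Prop :=
  0 < u /\ exists2 w, u < w &
    forall v, 0 < v -> (f v = 0 <-> v = u \/ v = w).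

(* This is K(b, A) when um is the maximizer u_m(b) of G(b, .). *)
Definition K (R : realType) (b A um : R) : R :=
  (1 - A ^+ 2) + A ^+ 2 * G b um.

Definition fifth_root (R : realType) (x : R) : R := x `^ (1 / 5).

(* Main.v *)
Require Import Defs.
From HB Require Import structures.
From mathcomp Require Import all_boot all_order all_algebra.
From mathcomp Require Import fraction zify ring lra.
From mathcomp Require Import mpoly.
From mathcomp Require Import boolp reals sequences exp.
Set Implicit Arguments.
Unset Strict Implicit.
Unset Printing Implicit Defensive.
Import Order.TTheory GRing.Theory Num.Theory.
Local Open Scope ring_scope.

(** Normalize degrees by g0 = F + d_1 + ... + d_6 and write x, y for the
    degrees of the first and second syzygies.

    The coefficient of t^n in the numerator of the Hilbert series is the Euler
    characteristic of the simplicial complex of the sets A of generators such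
    that n - sum(A) lies in the semigroup.  Its homology has the numbers of
    syzygies of degree n as dimensions ([twist_count_homology]): a minimal
    resolution shifts the Koszul homology of k[S] down, one step at a time, to
    the constants of its modules ([dimension_shift]).  Symmetry of the semigroup
    makes the complexes of degrees n and g0 - n Alexander dual, so the
    resolution is self-dual ([twist_count_dual]) and g0 is the degree of the
    last syzygy.

    The numerator vanishes to order 5 at t = 1 with leading coefficient
    the product pi of the generators.  Hence, for a polynomial p of degree at
    most 5 with p(1 - t) = - p(t) and coefficient p_5 of t^5, the sum
    p(0) - sum p(x/g0) + sum p(y/g0) equals - 60 pi p_5 / g0^5
    ([scaled_moment]).  Two choices of p bound pi.

    - The Chebyshev polynomial of degree 5 is bounded by 1 on the interval,
      which gives 360 pi / g0^5 <= (3/128) (beta_1 + B_6) ([chebyshev_bound]).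
    - The primitive of the square of t (1 - t) - 1/6 is increasing.  There are
      at least as many second as first syzygies above any given degree: the
      columns of the second syzygy matrix that lie above that degree are
      linearly independent unless they are all columns ([card_twist_gt]), and
      beta_1 <= beta_2 ([betti_le]).  Hence
      360 pi / g0^5 <= B_6 / 6 ([monotone_bound]).

    Since u_m maximizes G(b, u), K(b, A) is at least its value with u_m replaced
    by 1/10.  That already exceeds the first bound over B_6 when b >= 1/5 and
    the second one when b <= 1/5 ([compare_bounds]).

    That the smaller positive root of the cubic is the maximizer follows from
    1 + x <= exp x applied to each factor of G(b, v) / G(b, u): the exponents
    add up to a negative multiple of (v - u)^2 ([cubic_root_maximizes]). *)

(** * Matrices indexed by finite types, and dimensions modulo a subspace *)
Section FinMatrix.
Variable K : fieldType.

Definition fin_mx (S T : finType) (f : S -> T -> K) : 'M[K]_(#|S|, #|T|) :=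
  \matrix_(i, j) f (enum_val i) (enum_val j).

Definition fin_row (T : finType) (v : T -> K) : 'rV[K]_#|T| :=
  \row_j v (enum_val j).

Lemma sum_enum_val (T : finType) (V : nmodType) (F : T -> V) :
  \sum_(i < #|T|) F (enum_val i) = \sum_a F a.
Proof.
rewrite [RHS](reindex_onto enum_val enum_rank) => [|a _]; last exact: enum_rankK.
by apply: eq_bigl => i; rewrite enum_valK eqxx.
Qed.

Lemma mul_fin_mx (S T U : finType) (f : S -> T -> K) (g : T -> U -> K) :
  fin_mx f *m fin_mx g = fin_mx (fun a c => \sum_b f a b * g b c).
Proof.
apply/matrixP => i j; rewrite !mxE -(sum_enum_val (fun b => f _ b * g b _)).
by apply: eq_bigr => l _; rewrite !mxE.
Qed.

Lemma mul_fin_row (T U : finType) (v : T -> K) (g : T -> U -> K) :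
  fin_row v *m fin_mx g = fin_row (fun c => \sum_b v b * g b c).
Proof.
apply/rowP => j; rewrite !mxE -(sum_enum_val (fun b => v b * g b _)).
by apply: eq_bigr => l _; rewrite !mxE.
Qed.

Lemma tr_fin_mx (S T : finType) (f : S -> T -> K) :
  (fin_mx f)^T = fin_mx (fun a b => f b a).
Proof. by apply/matrixP => i j; rewrite !mxE. Qed.

Lemma eq_fin_mx (S T : finType) (f g : S -> T -> K) :
  (forall a b, f a b = g a b) -> fin_mx f = fin_mx g.
Proof. by move=> fg; apply/matrixP => i j; rewrite !mxE. Qed.

Lemma eq_fin_row (T : finType) (f g : T -> K) : f =1 g -> fin_row f = fin_row g.
Proof. by move=> fg; apply/rowP => j; rewrite !mxE. Qed.

Lemma fin_row_inj (T : finType) (f g : T -> K) : fin_row f = fin_row g -> f =1 g.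
Proof. by move=> /rowP fg a; have := fg (enum_rank a); rewrite !mxE enum_rankK. Qed.

Lemma fin_rowE (T : finType) (v : 'rV[K]_#|T|) :
  v = fin_row (fun a => v 0 (enum_rank a)).
Proof. by apply/rowP => j; rewrite !mxE enum_valK. Qed.

Lemma fin_mx1 (T : finType) : fin_mx (fun a b : T => (a == b)%:R) = 1%:M.
Proof. by apply/matrixP => i j; rewrite !mxE (inj_eq enum_val_inj). Qed.

Definition coord_mx (T : finType) (P : pred T) :=
  fin_mx (fun a b => (P a && (a == b))%:R).

Lemma mul_coord_fin_mx (S T : finType) (P : pred S) (f : S -> T -> K) :
  coord_mx P *m fin_mx f = fin_mx (fun a b => (P a)%:R * f a b).
Proof.
rewrite mul_fin_mx; apply: eq_fin_mx => a c; rewrite (bigD1 a) //= big1 ?addr0 ?eqxx ?andbT //.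
by move=> b /negbTE ba; rewrite eq_sym ba andbF mul0r.
Qed.

Lemma mul_fin_mx_coord (S T : finType) (P : pred T) (f : S -> T -> K) :
  fin_mx f *m coord_mx P = fin_mx (fun a b => f a b * (P b)%:R).
Proof.
rewrite mul_fin_mx; apply: eq_fin_mx => a c; rewrite (bigD1 c) //= big1 ?addr0 ?eqxx ?andbT //.
by move=> b /negbTE ->; rewrite andbF mulr0.
Qed.

Lemma mul_fin_row_coord (T : finType) (P : pred T) (v : T -> K) :
  fin_row v *m coord_mx P = fin_row (fun a => v a * (P a)%:R).
Proof.
rewrite mul_fin_row; apply: eq_fin_row => c; rewrite (bigD1 c) //= big1 ?addr0 ?eqxx ?andbT //.
by move=> b /negbTE ->; rewrite andbF mulr0.
Qed.

Lemma fin_row_sub_coord (T : finType) (P : pred T) (v : T -> K) :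
  (fin_row v <= coord_mx P)%MS <-> forall a, ~~ P a -> v a = 0.
Proof.
split=> [/submxP [w] | vP].
  rewrite (fin_rowE w) mul_fin_row_coord => /fin_row_inj vE a /negbTE Pa.
  by rewrite vE Pa mulr0.
apply/submxP; exists (fin_row v); rewrite mul_fin_row_coord; apply: eq_fin_row => a.
by case: (boolP (P a)) => [_|/vP ->]; rewrite ?mulr1 ?mul0r.
Qed.

Lemma rank_coord_le (T : finType) (P : pred T) : (\rank (coord_mx P) <= #|P|)%N.
Proof.
pose c (a : T) : 'M[K]_#|T| := fin_mx (fun b b' => ((b == a) && (b == b'))%:R).
have -> : coord_mx P = \sum_(a | P a) c a.
  apply/matrixP => i j; rewrite summxE mxE.
  have [Pi|Pi] := boolP (P (enum_val i)).
    rewrite (bigD1 (enum_val i)) //= big1 ?addr0; first by rewrite mxE eqxx.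
    by move=> b /andP[_ /negbTE bi]; rewrite mxE eq_sym bi.
  rewrite big1 // => b Pb; rewrite mxE; case: eqP => // ib; rewrite ib in Pi.
  by rewrite Pb in Pi.
apply: leq_trans (_ : (\sum_(a | P a) \rank (c a) <= _)%N).
  elim/big_rec2: _ => [|a r M Pa le]; first by rewrite mxrank0.
  by apply: leq_trans (mxrank_add _ _) _; rewrite leq_add2l.
rewrite -sum1_card; apply: leq_sum => a _.
have -> : c a = (delta_mx (enum_rank a) 0 : 'cV_#|T|) *m delta_mx 0 (enum_rank a).
  apply/matrixP => i j; rewrite mul_delta_mx !mxE.
  rewrite -!(inj_eq enum_val_inj) !enum_rankK.
  by case: eqP => // ->; rewrite (eq_sym a).
by apply: leq_trans (mxrankM_maxl _ _) _; rewrite mxrank_delta.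
Qed.

(** Both P and its complement satisfy the upper bound [rank_coord_le], and the two
    ranks add up to at least the full dimension. *)
Lemma rank_coord (T : finType) (P : pred T) : \rank (coord_mx P) = #|P|.
Proof.
have one : coord_mx P + coord_mx (predC P) = 1%:M.
  rewrite -fin_mx1; apply/matrixP => i j; rewrite !mxE /=.
  by case: (P _); rewrite /= ?addr0 ?add0r.
have := mxrank_add (coord_mx P) (coord_mx (predC P)).
rewrite one mxrank1 => le1.
apply/eqP; rewrite eqn_leq rank_coord_le /= -(leq_add2r #|predC P|).
have -> : (#|P| + #|predC P|)%N = #|T| by rewrite -(cardC P).
by apply: leq_trans le1 _; rewrite leq_add2l rank_coord_le.
Qed.

End FinMatrix.

Section Modulo.
Variable K : fieldType.

(** For submodules B of Z this is the inequality r <= dim (Z / B). Families of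
    representatives avoid the construction of quotients of infinite-dimensional
    spaces of chains; [act] is the scalar multiplication by the base field. *)
Definition indep_mod (V : nmodType) (act : K -> V -> V) (Z B : V -> Prop)
    (r : nat) : Prop :=
  exists v : 'I_r -> V, (forall i, Z (v i)) /\
    forall c : 'I_r -> K, B (\sum_i act (c i) (v i)) -> forall i, c i = 0.

(** A linear relation that is total on Z and reflects boundaries induces an
    injection of Z / B into Z' / B'. *)
Lemma indep_mod_transfer (V V' : nmodType) act act' (Z B : V -> Prop)
    (Z' B' : V' -> Prop) (rel : V -> V' -> Prop) r :
  rel 0 0 ->
  (forall u u' v v', rel u u' -> rel v v' -> rel (u + v) (u' + v')) ->
  (forall c v v', rel v v' -> rel (act c v) (act' c v')) ->
  (forall v, Z v -> exists2 v', Z' v' & rel v v') ->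
  (forall v v', rel v v' -> B' v' -> B v) ->
  indep_mod act Z B r -> indep_mod act' Z' B' r.
Proof.
move=> rel0 relD relZ ZZ' B'B [v [Zv indv]].
have ex i : exists v' : V', Z' v' /\ rel (v i) v'.
  by have [v' ? ?] := ZZ' _ (Zv i); exists v'.
have /fin_all_exists [v' Pv'] := ex.
exists v'; split=> [i|c Bc]; first exact: (Pv' i).1.
apply: indv; apply: B'B Bc; elim/big_rec2: _ => // i x y _ xy.
by apply: relD => //; apply: relZ; exact: (Pv' i).2.
Qed.

Lemma indep_mod_rowspace n m1 m2 (Z : 'M[K]_(m1, n)) (B : 'M[K]_(m2, n)) r :
  (B <= Z)%MS ->
  indep_mod (fun c (v : 'rV[K]_n) => c *: v) (fun v => (v <= Z)%MS)
    (fun v => (v <= B)%MS) r <-> (r + \rank B <= \rank Z)%N.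
Proof.
move=> BZ; split.
  move=> [v [Zv indv]].
  pose M := \matrix_i v i.
  have cM (w : 'rV_r) : w *m M = \sum_i w 0 i *: v i.
    rewrite mulmx_sum_row; apply: eq_bigr => i _.
    by rewrite rowK.
  have MZ : (M <= Z)%MS by apply/row_subP => i; rewrite rowK.
  have capMB : (M :&: B)%MS = 0.
    apply/eqP; rewrite -submx0; apply/rV_subP => w.
    rewrite sub_capmx => /andP[/submxP[u ->] uB].
    suff -> : u = 0 by rewrite mul0mx sub0mx.
    by apply/rowP => i; rewrite mxE; apply: indv; rewrite -cM.
  have rM : \rank M = r.
    apply/eqP; rewrite -[_ == _]/(row_free M) -kermx_eq0; apply/eqP.
    apply/row_matrixP => i; rewrite row0; apply/rowP => j; rewrite mxE.
    have ker0 : ((\sum_j row i (kermx M) 0 j *: v j)%R <= B)%MS.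
      by rewrite -cM -row_mul mulmx_ker row0 sub0mx.
    by move: (indv _ ker0 j); rewrite !mxE.
  rewrite -{1}rM -mxrank_sum_cap capMB mxrank0 addn0.
  by apply: mxrankS; rewrite addsmx_sub MZ BZ.
move=> le.
have rk : (r <= \rank (Z :\: B)%MS)%N.
  have := mxrank_cap_compl Z B.
  have /eqmx_rank -> : (Z :&: B == B)%MS by apply/eqmxP/capmx_idPr.
  lia.
pose N := (pid_mx r : 'M_(r, _)) *m row_base (Z :\: B)%MS.
have Nfree : row_free N.
  by rewrite /row_free mxrankMfree ?row_base_free // rank_pid_mx.
have NZB : (N <= Z :\: B)%MS.
  by apply: submx_trans (submxMl _ _) _; rewrite eq_row_base.
exists (fun i => row i N); split=> [i|c].
  by apply: submx_trans (row_sub _ _) (submx_trans NZB (diffmxSl _ _)).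
have -> : \sum_i c i *: row i N = (\row_i c i) *m N.
  by rewrite mulmx_sum_row; apply: eq_bigr => i _; rewrite mxE.
move=> cB i.
have : (\row_i c i *m N <= (Z :\: B) :&: B)%MS.
  by rewrite sub_capmx cB andbT (submx_trans (submxMl _ _)).
rewrite capmx_diff submx0 mulmx_free_eq0 // => /eqP/rowP/(_ i).
by rewrite !mxE.
Qed.

End Modulo.

(** * The Koszul differential *)
(** An antisymmetric double sum is zero even in characteristic 2, provided that the
    diagonal vanishes: the terms with j < l cancel those with l < j. *)
Lemma sum_antisym (m : nat) (V : zmodType) (F : 'I_m -> 'I_m -> V) :
  (forall j, F j j = 0) -> (forall j l, F j l = - F l j) ->
  \sum_j \sum_l F j l = 0.
Proof.
move=> F0 FN.
have -> : \sum_j \sum_l F j l =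
    \sum_(j < m) \sum_(l < m | (j < l)%N) F j l +
    \sum_(j < m) \sum_(l < m | (l < j)%N) F j l.
  rewrite -big_split; apply: eq_bigr => j _ /=.
  rewrite (bigID (fun l : 'I_m => (j < l)%N)) /=; congr (_ + _).
  rewrite (bigD1 j) ?ltnn //= F0 add0r; apply: eq_bigl => l.
  by rewrite -leqNgt ltn_neqAle andbC.
rewrite [X in _ + X](exchange_big_dep xpredT) //= -big_split /=.
rewrite big1 // => j _; rewrite -big_split /= big1 // => l _.
by rewrite FN addNr.
Qed.

Section Koszul.
Variables (m : nat) (K : comNzRingType).
Implicit Types A B : {set 'I_m}.

Definition face_sign A (j : 'I_m) : K := (-1) ^+ #|[set a in A | (a < j)%N]|.

(** Inserting j before l moves the position of l by one. *)
Lemma face_sign_setU1 A (j l : 'I_m) : j \notin A ->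
  face_sign (j |: A) l = (-1) ^+ (j < l)%N * face_sign A l.
Proof.
move=> jA; rewrite /face_sign -exprD; congr (_ ^+ _).
have -> : [set a in j |: A | (a < l)%N] =
    (if (j < l)%N then [set j] else set0) :|: [set a in A | (a < l)%N].
  apply/setP => a; rewrite !inE.
  case: ifP => jl; rewrite !inE; have [->|_] //= := eqVneq a j;
    by rewrite jl ?andbF.
case: ifP => jl; last by rewrite set0U.
by rewrite cardsU1 inE (negbTE jA).
Qed.

Lemma face_sign_sqr A j : face_sign A j * face_sign A j = 1.
Proof. by rewrite /face_sign -expr2 -exprM mulnC exprM sqrrN !expr1n. Qed.

Lemma face_sign_swap A j l : j \notin A -> l \notin A -> j != l ->
  face_sign A j * face_sign (j |: A) l = - (face_sign A l * face_sign (l |: A) j).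
Proof.
move=> jA lA jl; rewrite !face_sign_setU1 //.
have := jl; rewrite -(inj_eq val_inj) /= neq_ltn => /orP[] lt;
  rewrite lt (ltnNge (nat_of_ord _)) ltnW //= expr0 expr1; ring.
Qed.

Variables (z : 'I_m -> K) (V : lmodType K).
Implicit Type v : {ffun {set 'I_m} -> V}.

(** A chain w stands for the sum of w A times the exterior monomial of A, and this is
    the contraction with z. The case z = 1 is the boundary of a simplicial complex,
    augmented by the empty face; z = (X_1, ..., X_m) is the Koszul complex. *)
Definition koszul v : {ffun {set 'I_m} -> V} :=
  [ffun A : {set 'I_m} => \sum_(j | j \notin A) (face_sign A j * z j) *: v (j |: A)].

Lemma koszul_is_linear : linear koszul.
Proof.
move=> c u v; apply/ffunP => A; rewrite !ffunE scaler_sumr -big_split /=.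
apply: eq_bigr => j _; rewrite !ffunE scalerDr !scalerA; congr (_ *: _ + _).
by rewrite mulrC.
Qed.
HB.instance Definition _ := GRing.isLinear.Build K _ _ _ koszul koszul_is_linear.

Lemma koszul_koszul v : koszul (koszul v) = 0.
Proof.
apply/ffunP => A; rewrite !ffunE.
pose F j l := if [&& j \notin A, l \notin A & j != l] then
  (face_sign A j * face_sign (j |: A) l * (z j * z l)) *: v (l |: (j |: A)) else 0.
rewrite -[RHS](@sum_antisym _ _ F).
- rewrite big_mkcond /=; apply: eq_bigr => j _.
  case: ifP => jA; last by rewrite big1 // => l _; rewrite /F jA.
  rewrite ffunE scaler_sumr big_mkcond /=; apply: eq_bigr => l _.
  rewrite /F jA !inE negb_or andTb andbC eq_sym.
  case: ifP => // _; rewrite scalerA; congr (_ *: _).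
  ring.
- by move=> j; rewrite /F eqxx !andbF.
- move=> j l; rewrite /F eq_sym andbCA.
  case: ifP => [/and3P[lA jA lj] | _]; last by rewrite oppr0.
  by rewrite face_sign_swap 1?eq_sym // mulNr scaleNr (mulrC (z l)) setUCA.
Qed.

End Koszul.

(** * Homology of a simplicial complex of generator subsets *)
Section Simplicial.
Variables (k : fieldType) (m : nat).
Local Notation chain := {ffun {set 'I_m} -> k^o}.
Implicit Types (A B : {set 'I_m}) (v : chain) (D : pred {set 'I_m}).

Definition boundary (v : chain) : chain := koszul (fun=> 1) v.

Lemma boundaryE v A :
  boundary v A = \sum_(j | j \notin A) face_sign k A j * v (j |: A).
Proof. by rewrite ffunE; apply: eq_bigr => j _; rewrite mulr1. Qed.

Definition boundary_mx : 'M[k]_#|{set 'I_m}| :=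
  fin_mx (fun A B => \sum_(j | j \notin B) face_sign k B j * (A == j |: B)%:R).

Lemma mul_boundary_mx v :
  @fin_row k _ v *m boundary_mx = @fin_row k _ (boundary v).
Proof.
rewrite mul_fin_row; apply: eq_fin_row => B; rewrite boundaryE.
under eq_bigr do rewrite mulr_sumr.
rewrite exchange_big /=; apply: eq_bigr => j jB.
rewrite (bigD1 (j |: B)) //= big1 ?addr0 ?eqxx ?mulr1 1?mulrC //.
by move=> A /negbTE ->; rewrite !mulr0.
Qed.

Lemma boundary_mx_sqr : boundary_mx *m boundary_mx = 0.
Proof.
apply/row_matrixP => i; rewrite row0 -[boundary_mx *m _]mul1mx row_mul.
pose v : chain := [ffun A => row i 1%:M 0 (enum_rank A)].
have -> : row i (1%:M : 'M[k]_#|{set 'I_m}|) = @fin_row k _ v.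
  by rewrite [LHS]fin_rowE; apply: eq_fin_row => A; rewrite ffunE.
rewrite mulmxA !mul_boundary_mx. rewrite [boundary (boundary v)]koszul_koszul.
by apply/rowP => j; rewrite !mxE ffunE.
Qed.

Definition cell D (i : nat) : pred {set 'I_m} := fun A => D A && (#|A| == i).

(** The empty complex and the complex whose only face is the empty set are both
    allowed, and have different homology. *)
Definition is_complex D := forall j A, j \notin A -> D (j |: A) -> D A.

Definition boundary_rank D i := \rank (coord_mx k (cell D i) *m boundary_mx).

Lemma coord_boundary D i : is_complex D ->
  coord_mx k (cell D i.+1) *m boundary_mx =
  coord_mx k (cell D i.+1) *m boundary_mx *m coord_mx k (cell D i).
Proof.
move=> cD; rewrite mul_coord_fin_mx mul_fin_mx_coord; apply: eq_fin_mx => A B.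
have [/andP[DA Ai]|] := boolP (cell D i.+1 A); last by rewrite !mul0r.
rewrite !mul1r mulr_suml; apply: eq_bigr => j jB.
case: eqP => [AE|_]; last by rewrite !mulr0 mul0r.
rewrite AE in DA Ai; rewrite /cell (cD _ _ jB DA) /=.
by move: Ai; rewrite cardsU1 jB add1n eqSS => ->; rewrite !mulr1.
Qed.

Lemma boundary_rank0 D : boundary_rank D 0 = 0%N.
Proof.
rewrite /boundary_rank mul_coord_fin_mx; apply/eqP; rewrite mxrank_eq0; apply/eqP.
apply/matrixP => a b; rewrite !mxE; set A := enum_val a; set B := enum_val b.
have [/andP[_ A0]|] := boolP (cell D 0 A); last by rewrite mul0r.
rewrite mul1r big1 // => j jB; case: eqP => [AE|_]; last by rewrite mulr0.
by move: A0; rewrite AE cardsU1 jB.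
Qed.

Lemma boundary_rank_over D i : (m < i)%N -> boundary_rank D i = 0%N.
Proof.
move=> mi; rewrite /boundary_rank.
have -> : coord_mx k (cell D i) = 0; last by rewrite mul0mx mxrank0.
apply/matrixP => a b; rewrite !mxE; case: andP => // -[/andP[_ /eqP Ai] _].
by have := max_card (enum_val a); rewrite Ai card_ord leqNgt mi.
Qed.

Definition cycles D i := (coord_mx k (cell D i) :&: kermx boundary_mx)%MS.
Definition boundaries D i := coord_mx k (cell D i.+1) *m boundary_mx.
(** The index is the cardinality of the faces, one more than their dimension. It
    matches the homological degree in the resolution. *)
Definition homology_dim D i := (\rank (cycles D i) - \rank (boundaries D i))%N.

Lemma boundaries_cycles D i : is_complex D -> (boundaries D i <= cycles D i)%MS.
Proof.
move=> cD; rewrite sub_capmx {1}/boundaries coord_boundary // submxMl /=.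
by apply/sub_kermxP; rewrite -mulmxA boundary_mx_sqr mulmx0.
Qed.

Lemma rank_cycles D i :
  (boundary_rank D i + \rank (cycles D i) = #|cell D i|)%N.
Proof. by rewrite mxrank_mul_ker rank_coord. Qed.

Lemma homology_dimE D i : is_complex D ->
  (homology_dim D i + boundary_rank D i + boundary_rank D i.+1 = #|cell D i|)%N.
Proof.
move=> /(@boundaries_cycles D i)/mxrankS; rewrite /homology_dim -(rank_cycles D i).
change (\rank (boundaries D i)) with (boundary_rank D i.+1) => le.
by rewrite addnAC subnK // addnC.
Qed.

Lemma fin_row_cycle D i v : (@fin_row k _ v <= cycles D i)%MS <->
  (forall A, ~~ cell D i A -> v A = 0) /\ boundary v = 0.
Proof.
rewrite /cycles sub_capmx; split.
  move=> /andP[/fin_row_sub_coord vD /sub_kermxP v0]; split=> //.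
  apply/ffunP; apply: (@fin_row_inj k); rewrite -mul_boundary_mx v0.
  by apply/rowP=> j; rewrite !mxE ffunE.
move=> [vD v0]; apply/andP; split; first exact/fin_row_sub_coord.
apply/sub_kermxP; rewrite mul_boundary_mx v0.
by apply/rowP=> j; rewrite !mxE ffunE.
Qed.

Lemma fin_row_boundary D i v : (@fin_row k _ v <= boundaries D i)%MS <->
  exists2 u : chain, (forall A, ~~ cell D i.+1 A -> u A = 0) & v = boundary u.
Proof.
split.
  move=> /submxP[w]; rewrite (fin_rowE w) mulmxA mul_fin_row_coord => E.
  exists [ffun A => w 0 (enum_rank A) * (cell D i.+1 A)%:R].
    by move=> A /negbTE nA; rewrite ffunE nA mulr0.
  apply/ffunP; apply: (@fin_row_inj k); rewrite E -mul_boundary_mx.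
  by congr (_ *m _); apply: eq_fin_row => A; rewrite ffunE.
move=> [u uD ->]; rewrite -mul_boundary_mx.
by apply: submxMr; apply/fin_row_sub_coord.
Qed.

End Simplicial.

Section Cone.
Variables (k : fieldType) (m : nat).
Local Notation chain := {ffun {set 'I_m.+1} -> k^o}.
Local Notation full := (predT : pred {set 'I_m.+1}).

Lemma face_sign_ord0 (A : {set 'I_m.+1}) : face_sign k A ord0 = 1.
Proof.
rewrite /face_sign; have -> : [set a in A | (a < @ord0 m)%N] = set0.
  by apply/setP => a; rewrite !inE andbF.
by rewrite cards0.
Qed.

(** The full simplex is a cone over the vertex 0: adjoining 0 to the faces that
    avoid it is a contracting homotopy. *)
Lemma simplex_acyclic i : (cycles k full i <= boundaries k full i)%MS.
Proof.
apply/rV_subP => w.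
have -> : w = @fin_row k _ ([ffun A => w 0 (enum_rank A)] : chain).
  by rewrite {1}[w]fin_rowE; apply: eq_fin_row => A; rewrite ffunE.
move: [ffun _ => _] => v /fin_row_cycle[vi v0]; apply/fin_row_boundary.
exists [ffun A : {set 'I_m.+1} => if ord0 \in A then v (A :\ ord0) else 0].
  move=> A /negbTE Ai; rewrite ffunE; case: ifP => // A0; apply: vi.
  by move: Ai; rewrite /cell /= (cardsD1 ord0) A0 add1n eqSS => ->.
apply/ffunP => A; rewrite boundaryE.
under eq_bigr do rewrite ffunE.
have [A0|A0] := boolP (ord0 \in A); last first.
  rewrite (bigD1 ord0) //= big1 => [|j /andP[jA j0]].
    by rewrite addr0 face_sign_ord0 mul1r setU11 setU1K.
  by rewrite !inE eq_sym (negbTE j0) (negbTE A0) mulr0.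
have := boundaryE v (A :\ ord0); rewrite v0 ffunE (bigD1 ord0) ?setD11 //=.
rewrite face_sign_ord0 mul1r setD1K // => /esym/eqP; rewrite addr_eq0 => /eqP ->.
rewrite -sumrN; apply: eq_big => [j | j /andP[jA j0]].
  rewrite !inE negb_and negbK; have [->|_] /= := eqVneq j ord0.
    by apply/esym/negbTE; rewrite negbK; exact: A0.
  by rewrite andbT.
have sgnA : face_sign k A j = - face_sign k (A :\ ord0) j.
  rewrite -{1}(setD1K A0) face_sign_setU1 ?setD11 //.
  have -> : (@ord0 m < j)%N.
    by rewrite lt0n; apply: contra j0 => /eqP j0; apply/eqP/val_inj.
  by rewrite expr1 mulN1r.
have -> : ord0 \in j |: A by rewrite inE A0 orbT.
rewrite sgnA mulNr; congr (- (_ * v _)).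
apply/setP => a; rewrite !inE; have [->|] //= := eqVneq a ord0.
by rewrite eq_sym (negbTE j0).
Qed.

Lemma card_cell_simplex i :
  (#|cell full i| = boundary_rank k full i + boundary_rank k full i.+1)%N.
Proof.
have cT : is_complex full by [].
rewrite -(rank_cycles k); congr (_ + _)%N; apply/eqP.
by rewrite eqn_leq (mxrankS (simplex_acyclic i)) (mxrankS (boundaries_cycles _ _ cT)).
Qed.

End Cone.

(** * Combinatorial Alexander duality *)
(** The matrix is the transpose of g, conjugated by the monomial matrix of c and e. *)
Lemma rank_fin_mx_twist (k : fieldType) (T : finType) (g : T -> T -> k)
    (e : T -> k) (c : T -> T) :
  (forall a, e a != 0) -> involutive c ->
  \rank (fin_mx (fun a b => e a * g (c b) (c a) * e b)) = \rank (fin_mx g).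
Proof.
move=> e0 cK; pose M := fin_mx (fun a b => e a * (b == c a)%:R).
have Mu : M \in unitmx.
  have /mulmx1_unit[] // :
      M *m fin_mx (fun a b => (e b)^-1 * (a == c b)%:R) = 1%:M.
  rewrite mul_fin_mx -fin_mx1; apply: eq_fin_mx => a b.
  rewrite (bigD1 (c a)) //= big1 ?addr0 => [|x /negbTE xa]; last first.
    by rewrite xa mulr0 mul0r.
  rewrite eqxx mulr1 (inj_eq (inv_inj cK)); case: eqP => [->|]; last by rewrite !mulr0.
  by rewrite mulr1 divff.
have -> : fin_mx (fun a b => e a * g (c b) (c a) * e b) = M *m (fin_mx g)^T *m M^T.
  have -> : M *m (fin_mx g)^T = fin_mx (fun a b => e a * g b (c a)).
    rewrite tr_fin_mx mul_fin_mx; apply: eq_fin_mx => a b.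
    rewrite (bigD1 (c a)) //= big1 ?addr0 => [|x /negbTE xa]; last first.
      by rewrite xa mulr0 mul0r.
    by rewrite eqxx mulr1.
  rewrite tr_fin_mx mul_fin_mx; apply: eq_fin_mx => a b.
  rewrite (bigD1 (c b)) //= big1 ?addr0 => [|x /negbTE xb]; last first.
    by rewrite xb !mulr0.
  by rewrite eqxx mulr1.
rewrite mxrankMfree ?row_free_unit ?unitmx_tr //.
by rewrite (eqmxMfull _ _) ?row_full_unit // mxrank_tr.
Qed.

Section Duality.
Variables (k : fieldType) (m : nat).
Implicit Types (A B : {set 'I_m}) (D : pred {set 'I_m}).

Definition dual_complex D : pred {set 'I_m} := fun A => ~~ D (~: A).

Definition face_coef A B : k := \sum_(j | j \notin B) face_sign k B j * (A == j |: B)%:R.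

(** The correction that turns complementation into an anti-automorphism of the
    boundary matrix. *)
Definition parity A : k := (-1) ^+ (\sum_(a in A) a)%N.

(** Of the j elements below j, those outside B are those outside A. *)
Lemma face_sign_setC A B j : j \notin B -> A = j |: B ->
  face_sign k (~: A) j = parity A * face_sign k B j * parity B.
Proof.
move=> jB ->; rewrite /parity big_setU1 //= exprD.
have sq : face_sign k (~: (j |: B)) j * face_sign k B j = (-1) ^+ j.
  rewrite /face_sign -exprD; congr (_ ^+ _).
  rewrite -cardsUI [X in (_ + X)%N]eq_card0 ?addn0; last first.
    by move=> a; rewrite !inE; case: (a \in B); rewrite ?orbT ?andbF.
  rewrite -[RHS](card_ord j).
  pose w : 'I_j -> 'I_m := widen_ord (ltnW (ltn_ord j)).
  have wi : injective w by move=> a b /(congr1 val) /= ab; apply: val_inj.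
  rewrite -cardsT -(card_imset _ wi); congr #|pred_of_set _|; apply/setP => a.
  rewrite !inE; apply/idP/imsetP => [|[b _ ->]].
    case/orP => /andP[_ aj]; exists (Ordinal aj) => //; exact: val_inj.
  have wbj : w b != j by rewrite -(inj_eq val_inj) /= neq_ltn ltn_ord.
  by rewrite (negbTE wbj) /= ltn_ord !andbT orNb.
have ss := face_sign_sqr k B j.
have pp : (-1) ^+ (\sum_(a in B) a) * (-1) ^+ (\sum_(a in B) a) = 1 :> k.
  by rewrite -exprD addnn -mul2n exprM sqrrN expr1n expr1n.
have E (x s u q : k) : x * s = u -> s * s = 1 -> q * q = 1 -> x = u * q * s * q.
  move=> <- ss1 qq1; transitivity (x * (s * s) * (q * q)); last by ring.
  by rewrite ss1 qq1 !mulr1.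
exact: E sq ss pp.
Qed.

(** Complementation exchanges the boundary with the coboundary, up to the diagonal
    change of basis given by [parity]. *)
Lemma face_dual A B : face_coef A B = parity A * face_coef (~: B) (~: A) * parity B.
Proof.
rewrite /face_coef mulr_sumr mulr_suml big_mkcond [RHS]big_mkcond.
apply: eq_bigr => j _ /=; rewrite inE negbK.
have eqC : j \in A -> (~: B == j |: ~: A) = (j \notin B) && (A == j |: B).
  move=> jA; apply/eqP/andP => [/setP E | [jB /eqP ->]].
    split; first by have := E j; rewrite !inE eqxx.
    apply/eqP/setP => a; have := E a; rewrite !inE.
    have [->|_] /= := eqVneq a j; first by rewrite jA.
    by case: (a \in A); case: (a \in B).
  apply/setP => a; rewrite !inE; have [->|_] //= := eqVneq a j.
case: (boolP (j \in A)) => jA; last first.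
  case: ifP => // jB; case: eqP => [AE|_]; last by rewrite mulr0.
  by move: jA; rewrite AE setU11.
rewrite eqC //; case: (boolP (j \notin B)) => jB; last by rewrite !mulr0 mul0r.
case: eqP => [AE|_]; last by rewrite !mulr0 mul0r.
rewrite !mulr1 (face_sign_setC jB AE).
have pp C : parity C * parity C = 1.
  by rewrite -exprD addnn -mul2n exprM sqrrN expr1n expr1n.
have E (x u w : k) : u * u = 1 -> w * w = 1 -> x = u * (u * x * w) * w.
  move=> uu ww; transitivity ((u * u) * x * (w * w)); last by ring.
  by rewrite uu ww mul1r mulr1.
exact: E (pp A) (pp B).
Qed.

Lemma simplex_cycles_sub_boundaries p : (0 < m)%N ->
  (cycles k (predT : pred {set 'I_m}) p <= boundaries k predT p)%MS.
Proof. by case: m => // n _; exact: simplex_acyclic. Qed.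

(** By [face_dual], the boundary of the dual complex is the transpose of the
    boundary of the full simplex followed by the projection on the non-faces of D.
    On the image of that boundary, which consists of all cycles by acyclicity, the
    kernel of the projection is the space of cycles of D. *)
Lemma boundary_rank_dual D i p : (0 < m)%N -> (i + p = m)%N ->
  (boundary_rank k (dual_complex D) i + #|cell D p| =
   boundary_rank k (predT : pred {set 'I_m}) p.+1 + boundary_rank k D p)%N.
Proof.
move=> m0 ip.
pose P : pred {set 'I_m} := fun A => ~~ D A && (#|A| == p).
have -> : boundary_rank k (dual_complex D) i =
    \rank (boundary_mx k m *m coord_mx k P).
  rewrite mul_fin_mx_coord -(rank_fin_mx_twist _ (e := parity) (c := @setC _)) ?setCK; last 2 first.
  - by move=> A; rewrite /parity signr_eq0.
  - exact: setCK.
  rewrite /boundary_rank mul_coord_fin_mx; congr (\rank _); apply: eq_fin_mx => A B.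
  rewrite -/(face_coef A B) -/(face_coef (~: B) (~: A)) face_dual.
  have -> : P (~: A) = cell (dual_complex D) i A.
    rewrite /P /cell /dual_complex; congr (_ && _).
    have := cardsC A; rewrite card_ord -[X in _ = X]ip; lia.
  ring.
have -> : boundary_mx k m *m coord_mx k P =
    boundaries k predT p *m coord_mx k P.
  rewrite /boundaries mul_coord_fin_mx !mul_fin_mx_coord; apply: eq_fin_mx => A B.
  rewrite -/(face_coef A B) /P; case: (boolP (_ && _)) => [/andP[_ /eqP Bp]|];
    last by rewrite !mulr0.
  rewrite !mulr1 /face_coef mulr_sumr; apply: eq_bigr => j jB.
  case: eqP => [->|_]; last by rewrite !mulr0.
  by rewrite /cell cardsU1 jB Bp eqxx mul1r.
have := mxrank_mul_ker (boundaries k predT p) (coord_mx k P).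
rewrite -(rank_cycles k D p) -[\rank (boundaries _ _ _)]/(boundary_rank k _ p.+1) => <-.
suff -> : \rank (boundaries k predT p :&: kermx (coord_mx k P))%MS =
          \rank (cycles k D p) by rewrite -addnA; congr (_ + _)%N; rewrite addnC.
apply/eqP; rewrite eqn_leq; apply/andP; split; apply: mxrankS; apply/rV_subP => w;
  pose v : {ffun {set 'I_m} -> k^o} := [ffun A => w 0 (enum_rank A)];
  have -> : w = @fin_row k _ v
    by rewrite {1}[w]fin_rowE; apply: eq_fin_row => A; rewrite ffunE.
- rewrite sub_capmx => /andP[vB /sub_kermxP vP].
  have /fin_row_cycle[vp v0] : (@fin_row k _ v <= cycles k predT p)%MS.
    by apply: (submx_trans vB); apply: boundaries_cycles.
  apply/fin_row_cycle; split=> // A nA.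
  have [/andP[_ Ap]|] := boolP (cell predT p A); last exact: vp.
  have := vP; rewrite mul_fin_row_coord.
  have -> : 0 = @fin_row k _ (fun _ : {set 'I_m} => 0) by apply/rowP => j; rewrite !mxE.
  move=> /fin_row_inj/(_ A); rewrite /P Ap andbT.
  by move: nA; rewrite /cell Ap andbT => ->; rewrite mulr1.
move=> /fin_row_cycle[vp v0]; rewrite sub_capmx; apply/andP; split.
  apply: submx_trans (simplex_cycles_sub_boundaries p m0); apply/fin_row_cycle; split=> // A.
  by rewrite /cell /= => nA; apply: vp; rewrite /cell negb_and nA orbT.
apply/sub_kermxP; rewrite mul_fin_row_coord; apply/rowP => j; rewrite !mxE.
case: (boolP (P _)) => [/andP[nD _]|]; last by rewrite mulr0.
by rewrite vp ?mul0r // /cell negb_and nD.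
Qed.

Lemma card_cell_dual D i p : (i + p = m)%N ->
  (#|cell (dual_complex D) i| + #|cell D p| = #|cell (predT : pred {set 'I_m}) p|)%N.
Proof.
move=> ip; rewrite -(card_imset (cell (dual_complex D) i) (@setC_inj _)).
rewrite -(cardID D (cell predT p)) addnC; congr (_ + _)%N; apply: eq_card => A.
  by rewrite !inE /cell /= andbC.
rewrite !inE /cell /=; apply/imsetP/idP => [[B /andP[nD /eqP Bi] ->]|/andP[nD /eqP Ap]].
  rewrite [~~ _]nD /=; apply/eqP; have := cardsC B.
  by rewrite card_ord Bi -[X in _ = X -> _]ip => /addnI.
exists (~: A); rewrite ?setCK // unfold_in /dual_complex setCK [~~ _]nD /=.
by apply/eqP; have := cardsC A; rewrite card_ord Ap -[X in _ = X -> _]ip addnC => /addIn.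
Qed.

Lemma is_complex_dual D : is_complex D -> is_complex (dual_complex D).
Proof.
move=> cD j A jA; apply: contra => DA; apply: (cD j); first by rewrite !inE eqxx.
rewrite (_ : j |: _ = ~: A) //; apply/setP => a; rewrite !inE.
by have [->|] := eqVneq a j; rewrite ?jA.
Qed.

(** The rank form of Alexander duality: all terms that depend on the full simplex
    cancel by acyclicity. *)
Lemma homology_dim_dual D i p : is_complex D -> (i + p).+1 = m ->
  homology_dim k (dual_complex D) i = homology_dim k D p.
Proof.
move=> cD ip; have m0 : (0 < m)%N by lia.
have := homology_dimE k i (is_complex_dual cD).
have := homology_dimE k p cD.
have ip1 : (i + p.+1 = m)%N by lia.
have i1p : (i.+1 + p = m)%N by lia.
have := card_cell_dual D ip1.
have := boundary_rank_dual D m0 ip1; have := boundary_rank_dual D m0 i1p.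
have : (#|cell (predT : pred {set 'I_m}) p.+1| =
   boundary_rank k (predT : pred {set 'I_m}) p.+1 +
   boundary_rank k (predT : pred {set 'I_m}) p.+2)%N.
  by case: (m) m0 => // n _; exact: card_cell_simplex.
lia.
Qed.

(** The full face belongs to D only when D is the full simplex, which is acyclic. *)
Lemma homology_dim_top D : is_complex D -> (0 < m)%N -> homology_dim k D m = 0%N.
Proof.
move=> cD m0; have := homology_dimE k m cD; rewrite (boundary_rank_over k D (ltnSn m)).
have := boundary_rank_dual D m0 (add0n m).
rewrite boundary_rank0 (boundary_rank_over k _ (ltnSn m)); lia.
Qed.

Lemma homology_dim_simplex i : (0 < m)%N ->
  homology_dim k (predT : pred {set 'I_m}) i = 0%N.
Proof.
move=> m0; apply/eqP; rewrite subn_eq0.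
exact: mxrankS (simplex_cycles_sub_boundaries i m0).
Qed.

End Duality.

(** * Acyclicity of the Koszul complex of a polynomial ring *)
Section Contraction.
Variables (k : fieldType) (m : nat).
Local Notation R := {mpoly k[m]}.
Implicit Types (p : R) (mu nu : 'X_{1..m}) (i j l : 'I_m).

Lemma mcoeff_mulX i p nu :
  ('X_i * p)@_nu = if (0 < nu i)%N then p@_(nu - U_(i))%MM else 0.
Proof.
case: ifP => [nu0|nu0].
  have le : (U_(i) <= nu)%MM.
    by apply/mnm_lepP => l; rewrite mnm1E; case: eqP => [<-|].
  by rewrite -{1}(submK le) addmC mulrC mcoeffMX.
apply/eqP; rewrite mcoeff_eq0 mulrC (perm_mem (msuppMX _ _)).
apply/mapP => -[mu _ E]; move: nu0; rewrite E mnmDE mnm1E eqxx //.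
Qed.

Definition restrict_support (P : pred 'X_{1..m}) p : R :=
  \sum_(mu <- msupp p | P mu) p@_mu *: 'X_[mu].

Lemma mcoeff_restrict_support P p nu : (restrict_support P p)@_nu = if P nu then p@_nu else 0.
Proof.
rewrite /restrict_support raddf_sum /=.
under eq_bigr do rewrite mcoeffZ mcoeffX.
have [nup|nup] := boolP (nu \in msupp p); last first.
  rewrite (memN_msupp_eq0 nup) if_same big_seq_cond big1 // => mu /andP[mup _].
  by case: eqP => [E|_]; rewrite ?mulr0 //; rewrite -E mup in nup.
rewrite big_mkcond (bigD1_seq nu) ?msupp_uniq //= big1 ?addr0 => [|mu /negbTE ->].
  by rewrite eqxx mulr1.
by rewrite mulr0 if_same.
Qed.

Definition avoids_below (j : nat) nu := [forall l : 'I_m, (l < j)%N ==> (nu l == 0%N)].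

(** Let q be the sum of the terms of p in which the first variable that occurs is
    X_i. This is q / X_i. *)
Definition lead_quot i p : R :=
  \sum_(mu <- msupp p | (0 < mu i)%N && avoids_below i mu) p@_mu *: 'X_[(mu - U_(i))%MM].

Lemma avoids_below_addU (j : nat) i nu :
  avoids_below j (nu + U_(i))%MM = (j <= i)%N && avoids_below j nu.
Proof.
apply/forallP/andP => [H|[ji /forallP H] l].
  split.
    rewrite leqNgt; apply/negP => ij; have := H i.
    by rewrite ij mnmDE mnm1E eqxx addn1.
  apply/forallP => l; apply/implyP => lj; have := H l.
  by rewrite lj mnmDE addn_eq0 => /andP[].
apply/implyP => lj; rewrite mnmDE (eqP (implyP (H l) lj)) mnm1E.
by have /negbTE -> : i != l by rewrite -(inj_eq val_inj) /=; lia.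
Qed.

Lemma mcoeff_lead_quot i p nu :
  (lead_quot i p)@_nu = if avoids_below i nu then p@_(nu + U_(i))%MM else 0.
Proof.
rewrite /lead_quot raddf_sum /=.
under eq_bigr do rewrite mcoeffZ mcoeffX.
have avoidsE : avoids_below i (nu + U_(i))%MM = avoids_below i nu.
  by rewrite avoids_below_addU leqnn.
have [nup|nup] := boolP ((nu + U_(i))%MM \in msupp p); last first.
  rewrite (memN_msupp_eq0 nup) if_same big_seq_cond big1 // => mu /and3P[mup mui _].
  case: eqP => [E|_]; rewrite ?mulr0 //; move: nup; rewrite -E submK ?mup //.
  by apply/mnm_lepP => l; rewrite mnm1E; case: eqP => [<-|].
rewrite big_mkcond (bigD1_seq (nu + U_(i))%MM) ?msupp_uniq //= big1 ?addr0.
  rewrite mnmDE mnm1E eqxx addn1 /= avoidsE addmK eqxx mulr1 //.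
move=> mu nmu; case: ifP => // /andP[mui _].
have le : (U_(i) <= mu)%MM.
  by apply/mnm_lepP => l; rewrite mnm1E; case: eqP => [<-|].
case: eqP => [E|_]; rewrite ?mulr0 //.
by rewrite -E submK ?eqxx in nmu.
Qed.

Lemma lead_quot_is_additive i : additive (lead_quot i).
Proof.
move=> p q; apply/mpolyP => nu.
by rewrite mcoeffB !mcoeff_lead_quot mcoeffB; case: ifP; rewrite ?subr0.
Qed.
HB.instance Definition _ i := GRing.isAdditive.Build R R (lead_quot i) (lead_quot_is_additive i).

Lemma lead_quot_sign i n p : lead_quot i ((-1) ^+ n * p) = (-1) ^+ n * lead_quot i p.
Proof. by rewrite -signr_odd !mulr_sign; case: odd; rewrite ?raddfN. Qed.

Lemma lead_quot_mulX_lt i j p : (i < j)%N -> lead_quot j ('X_i * p) = 0.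
Proof.
move=> ij; apply/mpolyP => nu; rewrite mcoeff_lead_quot mcoeff0 mcoeff_mulX.
case: ifP => // /forallP/(_ i)/implyP/(_ ij)/eqP nui.
rewrite mnmDE nui mnm1E.
by have /negbTE -> : j != i by rewrite -(inj_eq val_inj) /=; lia.
Qed.

Lemma lead_quot_mulX_eq i p : lead_quot i ('X_i * p) = restrict_support (avoids_below i) p.
Proof.
apply/mpolyP => nu; rewrite mcoeff_lead_quot mcoeff_restrict_support mcoeff_mulX.
by rewrite mnmDE mnm1E eqxx addn1 /= addmK.
Qed.

Lemma lead_quot_mulX_gt i j p : (j < i)%N -> lead_quot j ('X_i * p) = 'X_i * lead_quot j p.
Proof.
move=> ji; apply/mpolyP => nu; rewrite mcoeff_lead_quot !mcoeff_mulX mcoeff_lead_quot.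
have ij : (j == i) = false by apply/negbTE; rewrite -(inj_eq val_inj) /=; lia.
rewrite mnmDE mnm1E ij addn0; case: (ltnP 0 (nu i)) => nui; last by rewrite if_same.
have le : (U_(i) <= nu)%MM.
  by apply/mnm_lepP => l; rewrite mnm1E; case: eqP => [<-|].
have -> : (nu + U_(j) - U_(i))%MM = (nu - U_(i) + U_(j))%MM.
  apply/mnmP => l; rewrite mnmBE !mnmDE mnmBE addnBAC //.
  by have /mnm_lepP := le.
by rewrite -{1}(submK le) avoids_below_addU (ltnW ji).
Qed.

(** Each nonconstant monomial has exactly one first variable. *)
Lemma sum_mulX_lead_quot n p : (n <= m)%N ->
  \sum_(i < m | (i < n)%N) 'X_i * lead_quot i p = p - restrict_support (avoids_below n) p.
Proof.
elim: n => [_|n IH nm].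
  rewrite big_pred0 //; apply/esym/eqP; rewrite subr_eq0; apply/eqP/mpolyP => nu.
  by rewrite mcoeff_restrict_support; case: ifP => // /negP[]; apply/forallP.
rewrite (bigD1 (Ordinal nm)) //=.
rewrite (eq_bigl (fun i : 'I_m => (i < n)%N)) => [|i]; last first.
  by rewrite -(inj_eq val_inj) /= ltnS [RHS]ltn_neqAle andbC.
rewrite IH 1?ltnW //; apply/mpolyP => nu.
rewrite [LHS]mcoeffD !mcoeffB mcoeff_mulX !mcoeff_restrict_support mcoeff_lead_quot.
set i := Ordinal nm.
have avoidsS : avoids_below n.+1 nu = avoids_below n nu && (nu i == 0%N).
  apply/forallP/andP => [H|[/forallP H nui] l].
    split; last by have := H i; rewrite ltnSn.
    by apply/forallP=> l; apply/implyP => ln; have := H l; rewrite ltnS ltnW.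
  apply/implyP; rewrite ltnS leq_eqVlt => /orP[/eqP ln|ln]; last exact: implyP (H l) ln.
  by have -> : l = i by apply/val_inj.
rewrite avoidsS; case: (posnP (nu i)) => nui; first by rewrite /= add0r andbT.
have le : (U_(i) <= nu)%MM.
  by apply/mnm_lepP => l; rewrite mnm1E; case: eqP => [<-|].
have -> : avoids_below n (nu - U_(i))%MM = avoids_below n nu.
  by rewrite -[in RHS](submK le) avoids_below_addU leqnn.
by rewrite submK //= andbF subr0; case: ifP => _; ring.
Qed.


Lemma restrict_support_constant p : restrict_support (avoids_below m) p = (p@_0%MM)%:MP.
Proof.
apply/mpolyP => nu; rewrite mcoeff_restrict_support mcoeffC.
have -> : avoids_below m nu = (nu == 0%MM).
  apply/forallP/eqP => [H|-> l]; last by rewrite mnm0E implybT.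
  by apply/mnmP => l; have := H l; rewrite ltn_ord mnm0E => /eqP.
by case: eqP => [->|_]; rewrite ?mulr1 ?mulr0.
Qed.

Definition min_elt (A : {set 'I_m}) : option 'I_m :=
  [pick j in A | [forall l in A, (j <= l)%N]].

Lemma min_eltP A : match min_elt A with
  | Some j => j \in A /\ forall l, l \in A -> (j <= l)%N
  | None => A = set0 end.
Proof.
rewrite /min_elt; case: pickP => [j /andP[jA /forallP H]|H].
  by split=> // l lA; have := H l; rewrite lA.
case: (set_0Vmem A) => [->//|[a aA]].
case: (arg_minnP (fun i : 'I_m => i : nat) aA) => i iA Hi.
have /negP[] := H i; apply/andP; split=> //.
by apply/forallP => l; apply/implyP; exact: Hi.
Qed.

Lemma min_elt_eq (A : {set 'I_m}) j : j \in A ->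
  (forall l, l \in A -> (j <= l)%N) -> min_elt A = Some j.
Proof.
move=> jA Hj; have := min_eltP A; case: min_elt => [i [iA Hi]|A0].
  by congr Some; apply/val_inj/eqP; rewrite eqn_leq Hi // Hj.
by rewrite A0 inE in jA.
Qed.

(** Each multidegree part of the Koszul complex is the chain complex of the simplex on
    the variables that occur. This is the cone contraction to the first of them, in
    all multidegrees at once. *)
Definition homotopy (f : {set 'I_m} -> R) (A : {set 'I_m}) : R :=
  if min_elt A is Some j then lead_quot j (f (A :\ j)) else 0.

(** At a set A with least element i, the terms of the contracted boundary for j < i
    add up to the terms of f A with a variable before X_i. The condition that f is a
    cycle, divided by X_i, evaluates the terms for j > i to the remaining terms.
    At the empty set only the constant term is not recovered, and it is zero. *)
Lemma koszul_contraction (f : {set 'I_m} -> R) :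
  (forall A : {set 'I_m}, \sum_(j | j \notin A) face_sign R A j * 'X_j * f (j |: A) = 0) ->
  (f set0)@_0%MM = 0 ->
  forall A : {set 'I_m},
    \sum_(j | j \notin A) face_sign R A j * 'X_j * homotopy f (j |: A) = f A.
Proof.
move=> f0 fc A; have := min_eltP A; case minA: min_elt => [i|]; last first.
  move=> ->; have <- : f set0 - restrict_support (avoids_below m) (f set0) = f set0.
    by rewrite restrict_support_constant fc mpolyC0 subr0.
  rewrite -sum_mulX_lead_quot //.
apply: eq_big => j; first by rewrite inE ltn_ord.
  move=> _; rewrite setU0 /homotopy (@min_elt_eq _ j) ?set11 //; last first.
    by move=> l /set1P ->.
  rewrite setDv /face_sign (_ : [set a in _ | _] = set0) ?cards0 ?mul1r //.
  by apply/setP => a; rewrite !inE.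
move=> [iA Hi].
have face_sign_lt j : (j <= i)%N -> face_sign R A j = 1.
  move=> ji; rewrite /face_sign (_ : [set a in _ | _] = set0) ?cards0 //.
  apply/setP => a; rewrite !inE; apply/negbTE; rewrite negb_and -leqNgt -implybE.
  by apply/implyP => /Hi; exact: leq_trans.
have sgnA j : (i < j)%N -> face_sign R A j = - face_sign R (A :\ i) j.
  by move=> ij; rewrite -{1}(setD1K iA) face_sign_setU1 ?setD11 // ij expr1 mulN1r.
have sgni : face_sign R (A :\ i) i = 1.
  rewrite /face_sign (_ : [set a in _ | _] = set0) ?cards0 //.
  apply/setP => a; rewrite !inE; apply/negbTE; apply/negP => /andP[/andP[_ /Hi ia]].
  by rewrite ltnNge ia.
have := f0 (A :\ i) => /(congr1 (lead_quot i)); rewrite raddf0 raddf_sum /=.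
rewrite (bigD1 i) ?setD11 //= sgni mul1r lead_quot_mulX_eq setD1K // => E.
rewrite (bigID (fun j : 'I_m => (j < i)%N)) /=.
have -> : \sum_(j | (j \notin A) && (j < i)%N) face_sign R A j * 'X_j * homotopy f (j |: A)
    = f A - restrict_support (avoids_below i) (f A).
  rewrite -sum_mulX_lead_quot 1?ltnW //; apply: eq_big => [j|j /andP[jA ji]].
    by case: (ltnP j i) => ji; rewrite ?andbF // andbT; apply/negP => /Hi; rewrite leqNgt ji.
  rewrite face_sign_lt 1?ltnW // mul1r /homotopy (@min_elt_eq _ j) ?setU11 ?setU1K //.
  by move=> l /setU1P[->//|/Hi]; apply: leq_trans; exact: ltnW.
rewrite -addrA -[RHS]addr0; congr (_ + _); apply/eqP.
move: E => /eqP; rewrite addr_eq0 => /eqP ->; rewrite opprK addr_eq0; apply/eqP.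
rewrite (bigID (fun j : 'I_m => (j < i)%N)) /= big1 ?add0r; last first.
  by move=> j /andP[/andP[jA ji] lt]; rewrite -mulrA lead_quot_sign lead_quot_mulX_lt // mulr0.
rewrite -sumrN; apply: eq_big => j.
  rewrite !inE; have [->|] //= := eqVneq j i; rewrite ?ltnn ?andbT ?andbF ?iA //=.
move=> /andP[/andP[jA ji] lt].
have ij : (i < j)%N by move: ji; rewrite -(inj_eq val_inj) /=; lia.
have jA' : j \notin A by move: jA; rewrite !inE ji.
rewrite -mulrA lead_quot_sign lead_quot_mulX_gt // sgnA // -mulrA mulNr opprK /homotopy.
rewrite (@min_elt_eq _ i) ?inE ?iA ?orbT //; last first.
  by move=> l /setU1P[->|/Hi] //; exact: ltnW.
congr (_ * (_ * lead_quot i (f _))); apply/setP => a; rewrite !inE.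
by have [->|] //= := eqVneq a j; rewrite ji.
Qed.
End Contraction.

(** * Dimension shifting along the resolution *)
(** Multiplication by a homogeneous polynomial q shifts homogeneous components; P and Q
    are the conditions on degrees before and after the shift. *)
Lemma restrict_supportM (k : fieldType) (m : nat) (P Q : pred 'X_{1..m}) (p q : {mpoly k[m]}) :
  (forall mu nu, nu \in msupp q -> Q (mu + nu)%MM = P mu) ->
  restrict_support Q (p * q) = restrict_support P p * q.
Proof.
move=> PQ; apply/mpolyP => nu; rewrite mcoeff_restrict_support !mcoeffM.
rewrite -[RHS]mul1r -[in LHS](mul1r (\sum_(_ | _) _)).
case: ifP => Qnu; last rewrite -[LHS](mul0r 1) mul0r; rewrite ?mul1r.
  apply: eq_bigr => -[a c] /= /eqP nuE; rewrite mcoeff_restrict_support.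
  have [/PQ PQc|/memN_msupp_eq0 ->] := boolP ((c : 'X_{1..m}) \in msupp q); last by rewrite !mulr0.
  by rewrite -PQc -nuE Qnu.
rewrite big1 // => -[a c] /= /eqP nuE; rewrite mcoeff_restrict_support.
have [/PQ PQc|/memN_msupp_eq0 ->] := boolP ((c : 'X_{1..m}) \in msupp q); last by rewrite !mulr0.
by rewrite -PQc -nuE Qnu mul0r.
Qed.

Lemma restrict_support_is_additive (k : fieldType) (m : nat) (P : pred 'X_{1..m}) :
  additive (@restrict_support k m P).
Proof.
move=> p q; apply/mpolyP => nu.
by rewrite mcoeffB !mcoeff_restrict_support mcoeffB; case: ifP; rewrite ?subr0.
Qed.
HB.instance Definition _ (k : fieldType) (m : nat) (P : pred 'X_{1..m}) :=
  GRing.isAdditive.Build {mpoly k[m]} {mpoly k[m]} (@restrict_support k m P)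
    (restrict_support_is_additive P).

Section Comparison.
Variables (k : fieldType) (m : nat) (d : 'I_m -> nat) (C : free_sequence k m).
Hypothesis resC : is_minimal_graded_resolution d C.
Local Notation R := {mpoly k[m]}.
Local Notation b := (betti C).
Implicit Types (A B : {set 'I_m}).
Local Notation diff i := (differential C i).
(** The chains of the Koszul complex with coefficients in the i-th free module F_i. *)
Definition koszul_chain (i : nat) := {ffun {set 'I_m} -> 'rV[R]_(b i)}.

Definition weight (A : {set 'I_m}) : nat := (\sum_(j in A) d j)%N.

(** Modules over the polynomial ring carry no canonical structure of vector space over
    k, so that the scalar multiplication is a separate operation. *)
Definition const_scale (V : lmodType R) (c : k) (v : V) : V := c%:MP *: v.

Lemma diff_homog i r c mu : mu \in msupp (diff i r c) ->
  (wdeg d mu + twist c)%N = twist r.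
Proof. by case: resC => _ H _ _ _; apply: H. Qed.

Lemma diff_exact i (v : 'rV[R]_(b i.+1)) :
  (exists w, v = w *m diff i.+1) <-> v *m diff i = 0.
Proof. by case: resC => _ _ _ H _; apply: H. Qed.

Lemma diff_minimal i (u : 'rV[R]_(b i.+1)) c : ((u *m diff i) 0 c)@_0%MM = 0.
Proof.
case: resC => _ _ _ _ min; rewrite mxE raddf_sum big1 // => r _ /=.
by rewrite rmorphM /= min mulr0.
Qed.

Definition koszul_bd i (w : koszul_chain i) : koszul_chain i := koszul (fun j => 'X_j) w.

Definition apply_diff i (w : koszul_chain i.+1) : koszul_chain i := [ffun A => w A *m diff i].

Lemma koszul_bd_apply_diff i (w : koszul_chain i.+1) :
  koszul_bd (apply_diff w) = apply_diff (koszul_bd w).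
Proof.
apply/ffunP => A; rewrite !ffunE mulmx_suml; apply: eq_bigr => j _.
by rewrite ffunE scalemxAl.
Qed.

Lemma koszul_bd_const i (w : koszul_chain i) A c : (koszul_bd w A 0 c)@_0%MM = 0.
Proof.
rewrite ffunE summxE raddf_sum big1 // => j _ /=.
by rewrite mxE !rmorphM /= mcoeffX mnm1_eq0 mulr0 mul0r.
Qed.

(** The exterior monomial of A contributes its weight, so that both differentials
    preserve the degree n. *)
Definition homogeneous n i (w : koszul_chain i) := forall A c mu,
  mu \in msupp (w A 0 c) -> (wdeg d mu + twist c + weight A)%N = n.

Definition in_degree q i (w : koszul_chain i) := forall A, #|A| != q -> w A = 0.

Lemma wdegD mu nu : wdeg d (mu + nu)%MM = (wdeg d mu + wdeg d nu)%N.
Proof. by rewrite /wdeg -big_split /=; apply: eq_bigr => j _; rewrite mnmDE mulnDl. Qed.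

Lemma wdegU j : wdeg d U_(j)%MM = d j.
Proof.
rewrite /wdeg (bigD1 j) //= mnm1E eqxx mul1n big1 ?addn0 // => l lj.
by rewrite mnm1E eq_sym (negbTE lj).
Qed.

Lemma weightU1 j (A : {set 'I_m}) : j \notin A -> weight (j |: A) = (d j + weight A)%N.
Proof. by move=> jA; rewrite /weight big_setU1. Qed.

Lemma koszul_bd_in_degree q i (w : koszul_chain i) : in_degree q.+1 w -> in_degree q (koszul_bd w).
Proof.
move=> wq A Aq; rewrite ffunE big1 // => j jA; rewrite wq ?scaler0 //.
by rewrite cardsU1 jA.
Qed.

Lemma msuppMX1 (p : R) j mu : mu \in msupp ('X_j * p) ->
  exists2 nu, nu \in msupp p & mu = (nu + U_(j))%MM.
Proof.
rewrite mulrC (perm_mem (msuppMX _ _)) => /mapP[nu nup ->]; exists nu => //.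
by rewrite addmC.
Qed.

Lemma msupp_sign_mul (p : R) n : msupp ((-1) ^+ n * p) =i msupp p.
Proof.
move=> mu; rewrite -signr_odd mulr_sign; case: odd => //.
by rewrite (perm_mem (msuppN _)).
Qed.

Lemma koszul_bd_homogeneous n i (w : koszul_chain i) :
  homogeneous n w -> homogeneous n (koszul_bd w).
Proof.
move=> wn A c mu; rewrite ffunE summxE => /msupp_sum_le /flatten_mapP[j].
rewrite mem_filter => /andP[jA _]; rewrite mxE -mulrA msupp_sign_mul.
move=> /msuppMX1[nu /wn <- ->]; rewrite wdegD wdegU weightU1 //; lia.
Qed.

Lemma apply_diff_homogeneous n i (w : koszul_chain i.+1) :
  homogeneous n w -> homogeneous n (apply_diff w).
Proof.
move=> wn A c mu; rewrite ffunE mxE => /msupp_sum_le /flatten_mapP[r _].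
move=> /msuppM_le/allpairsP[[a e] /= [/wn <- /diff_homog <- ->]].
rewrite wdegD; lia.
Qed.

Definition contraction i (w : koszul_chain i) : koszul_chain i :=
  [ffun A => \row_c homotopy (fun B => w B 0 c) A].

Lemma contraction_homogeneous n i (w : koszul_chain i) :
  homogeneous n w -> homogeneous n (contraction w).
Proof.
move=> wn A c mu; rewrite ffunE mxE /homotopy; have := min_eltP A.
case: min_elt => [j [jA _]|_]; last by rewrite msupp0.
have -> : weight A = (d j + weight (A :\ j))%N.
  by rewrite -weightU1 ?setD11 ?setD1K.
rewrite mcoeff_msupp mcoeff_lead_quot; case: ifP => // _; last by rewrite eqxx.
rewrite -mcoeff_msupp => /wn <-; rewrite wdegD wdegU; lia.
Qed.

Lemma contraction_in_degree q i (w : koszul_chain i) :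
  in_degree q w -> in_degree q.+1 (contraction w).
Proof.
move=> wq A Aq; rewrite ffunE; apply/rowP => c; rewrite !mxE /homotopy.
have := min_eltP A; case: min_elt => [j [jA _]|_] //.
rewrite wq ?mxE ?raddf0 //; apply: contra Aq => /eqP Aq.
by rewrite (cardsD1 j) jA Aq.
Qed.

Definition no_constant i (w : koszul_chain i) := forall c, (w set0 0 c)@_0%MM = 0.

Lemma koszul_bd_contraction i (w : koszul_chain i) : koszul_bd w = 0 -> no_constant w ->
  koszul_bd (contraction w) = w.
Proof.
move=> w0 wc; apply/ffunP => A; apply/rowP => c; rewrite ffunE summxE.
rewrite -[RHS](@koszul_contraction _ _ (fun B => w B 0 c)) => [|B|].
- by apply: eq_bigr => j _; rewrite mxE ffunE mxE.
- have := congr1 (fun u : koszul_chain i => u B 0 c) w0; rewrite !ffunE summxE mxE => E.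
  by rewrite -[RHS]E; apply: eq_bigr => j _; rewrite mxE.
exact: wc.
Qed.

Definition component n q i (w : koszul_chain i) : koszul_chain i :=
  [ffun A : {set 'I_m} => if #|A| == q then
    \row_c restrict_support (fun mu => (wdeg d mu + twist c + weight A)%N == n) (w A 0 c) else 0].

Lemma component_homogeneous n q i (w : koszul_chain i) : homogeneous n (component n q w).
Proof.
move=> A c mu; rewrite ffunE; case: ifP => _; last by rewrite mxE msupp0.
rewrite mxE mcoeff_msupp mcoeff_restrict_support; case: ifP; last by rewrite eqxx.
by move=> /eqP.
Qed.

Lemma component_in_degree n q i (w : koszul_chain i) : in_degree q (component n q w).
Proof. by move=> A /negbTE Aq; rewrite ffunE Aq. Qed.

Lemma component_id n q i (w : koszul_chain i) :
  homogeneous n w -> in_degree q w -> component n q w = w.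
Proof.
move=> wn wq; apply/ffunP => A; rewrite ffunE; case: ifP => [_|/negbT/wq ->//].
apply/rowP => c; rewrite mxE; apply/mpolyP => mu; rewrite mcoeff_restrict_support.
case: eqP => // nmu; apply/esym/eqP; rewrite mcoeff_eq0; apply/negP => /wn; exact: nmu.
Qed.

Lemma component_apply_diff n q i (w : koszul_chain i.+1) :
  component n q (apply_diff w) = apply_diff (component n q w).
Proof.
apply/ffunP => A; rewrite !ffunE; case: ifP => _; last by rewrite mul0mx.
apply/rowP => c; rewrite !mxE raddf_sum; apply: eq_bigr => r _; rewrite mxE.
apply: restrict_supportM => mu nu /diff_homog E; by rewrite wdegD -E !addnA.
Qed.

(** Cycles and boundaries of the Koszul complex with coefficients in F_i / N_i, where
    N_i is the image of F_(i+1). They are represented by chains over F_i, and only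
    cycles are required to be homogeneous. *)
Definition rel_cycle n q i (w : koszul_chain i) :=
  [/\ homogeneous n w, in_degree q w & forall A, exists u, koszul_bd w A = u *m diff i].

Definition rel_boundary i (w : koszul_chain i) :=
  exists a : koszul_chain i, forall A, exists u, w A - koszul_bd a A = u *m diff i.

Lemma apply_diff_choice i (w : koszul_chain i) : (forall A, exists u, w A = u *m diff i) ->
  exists u : koszul_chain i.+1, w = apply_diff u.
Proof.
move=> /fin_all_exists[u uE]; exists [ffun A => u A]; apply/ffunP => A.
by rewrite !ffunE -uE.
Qed.

Lemma apply_diff0 i (w : koszul_chain i.+1) : apply_diff w = 0 ->
  forall A, exists u, w A = u *m diff i.+1.
Proof.
by move=> w0 A; apply/diff_exact; have := congr1 (fun u : koszul_chain i => u A) w0; rewrite !ffunE.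
Qed.

Lemma apply_diff_im i (w : koszul_chain i.+1) : (forall A, exists u, w A = u *m diff i.+1) ->
  apply_diff w = 0.
Proof. by move=> H; apply/ffunP => A; rewrite !ffunE; apply/diff_exact. Qed.

Lemma koszul_bdB i (u v : koszul_chain i) : koszul_bd (u - v) = koszul_bd u - koszul_bd v.
Proof. exact: raddfB. Qed.

Lemma koszul_bdK i (u : koszul_chain i) : koszul_bd (koszul_bd u) = 0.
Proof. exact: koszul_koszul. Qed.

Lemma apply_diffB i (u v : koszul_chain i.+1) : apply_diff (u - v) = apply_diff u - apply_diff v.
Proof. by apply/ffunP => A; rewrite !ffunE mulmxBl. Qed.

Lemma no_constantD i (u v : koszul_chain i) : no_constant u -> no_constant v ->
  no_constant (u + v).
Proof. by move=> u0 v0 c; rewrite ffunE mxE mcoeffD u0 v0 addr0. Qed.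

Lemma no_constantB i (u v : koszul_chain i) : no_constant u -> no_constant v ->
  no_constant (u - v).
Proof. by move=> u0 v0 c; rewrite !ffunE !mxE mcoeffB u0 v0 subr0. Qed.

Lemma no_constantZ i c (u : koszul_chain i) : no_constant u -> no_constant (const_scale c u).
Proof. by move=> u0 a; rewrite ffunE mxE rmorphM /= u0 mulr0. Qed.

Lemma no_constant_apply_diff i (u : koszul_chain i.+1) : no_constant (apply_diff u).
Proof. by move=> c; rewrite ffunE diff_minimal. Qed.

Lemma koszul_bd0 i : koszul_bd (0 : koszul_chain i) = 0.
Proof. exact: raddf0. Qed.

Lemma koszul_bdD i (u v : koszul_chain i) : koszul_bd (u + v) = koszul_bd u + koszul_bd v.
Proof. exact: raddfD. Qed.

Lemma koszul_bdZ i c (u : koszul_chain i) :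
  koszul_bd (const_scale c u) = const_scale c (koszul_bd u).
Proof. exact: linearZ. Qed.

Lemma apply_diffD i (u v : koszul_chain i.+1) : apply_diff (u + v) = apply_diff u + apply_diff v.
Proof. by apply/ffunP => A; rewrite !ffunE mulmxDl. Qed.

Lemma apply_diffZ i c (u : koszul_chain i.+1) :
  apply_diff (const_scale c u) = const_scale c (apply_diff u).
Proof. by apply/ffunP => A; rewrite !ffunE scalemxAl. Qed.

Lemma no_constant_in_degree q i (w : koszul_chain i) : in_degree q.+1 w -> no_constant w.
Proof. by move=> wq c; rewrite wq ?cards0 // mxE mcoeff0. Qed.

(** The connecting homomorphism of 0 -> N_i -> F_i -> F_i / N_i -> 0, followed by the
    isomorphism of F_(i+1) / N_(i+1) with N_i, is an isomorphism from degree q + 1 to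
    degree q. The Koszul complex of F_i contributes nothing: every cycle without
    constant term is a boundary, and by minimality no constants occur, even for q = 0. *)
Lemma dimension_shift n q i r :
  indep_mod (@const_scale _) (@rel_cycle n q.+1 i) (@rel_boundary i) r <->
  indep_mod (@const_scale _) (@rel_cycle n q i.+1) (@rel_boundary i.+1) r.
Proof.
split.
  apply: (indep_mod_transfer (rel := fun w u => koszul_bd w = apply_diff u /\ no_constant w)).
  - split=> [|c]; last by rewrite ffunE mxE mcoeff0.
    by rewrite koszul_bd0; apply/ffunP => A; rewrite !ffunE mul0mx.
  - move=> u u' v v' [E u0] [E' v0]; split; last exact: no_constantD.
    by rewrite koszul_bdD E E' apply_diffD.
  - move=> c v v' [E v0]; split; last exact: no_constantZ.
    by rewrite koszul_bdZ E apply_diffZ.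
  (* A preimage of the boundary exists by definition of a relative cycle; its
     component of degree n is one as well. *)
  - move=> w [wn wq /apply_diff_choice[u0 u0E]].
    have wE : koszul_bd w = apply_diff (component n q u0).
      rewrite -component_apply_diff -u0E component_id //; first exact: koszul_bd_homogeneous.
      exact: koszul_bd_in_degree.
    exists (component n q u0); last by split=> //; exact: no_constant_in_degree wq.
    split; [exact: component_homogeneous | exact: component_in_degree |].
    by apply: apply_diff0; rewrite -koszul_bd_apply_diff -wE koszul_bdK.
  - move=> w u [wE w0] [a aE].
    have ua : apply_diff (u - koszul_bd a) = 0.
      by apply: apply_diff_im => A; have [x xE] := aE A; exists x; rewrite -xE !ffunE.
    (* w' is a Koszul cycle over F_i without constant term, hence a boundary. *)
    pose w' := w - apply_diff a.
    have w'0 : koszul_bd w' = 0.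
      by rewrite koszul_bdB wE koszul_bd_apply_diff -apply_diffB ua.
    exists (contraction w') => A; rewrite koszul_bd_contraction //.
      by exists (a A); rewrite !ffunE opprB addrC addrNK.
    exact: no_constantB w0 (no_constant_apply_diff a).
apply: (indep_mod_transfer (rel := fun u w => koszul_bd w = apply_diff u)).
- by rewrite koszul_bd0; apply/ffunP => A; rewrite !ffunE mul0mx.
- by move=> u u' v v' E E'; rewrite koszul_bdD E E' apply_diffD.
- by move=> c v v' E; rewrite koszul_bdZ E apply_diffZ.
- move=> u [un uq uE].
  have uE' : koszul_bd (contraction (apply_diff u)) = apply_diff u.
    apply: koszul_bd_contraction; last exact: no_constant_apply_diff.
    by rewrite koszul_bd_apply_diff; apply: apply_diff_im.
  exists (contraction (apply_diff u)) => //; split.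
  + exact/contraction_homogeneous/apply_diff_homogeneous.
  + by apply/contraction_in_degree => A Aq; rewrite ffunE uq // mul0mx.
  + by move=> A; rewrite uE' ffunE; exists (u A).
move=> u w wE [a aE].
have [c cE] : exists c : koszul_chain i.+1, w - koszul_bd a = apply_diff c.
  by apply: apply_diff_choice => A; have [x xE] := aE A; exists x; rewrite !ffunE in xE *.
exists c => A.
have : apply_diff (u - koszul_bd c) = 0.
  by rewrite apply_diffB -wE -koszul_bd_apply_diff -cE koszul_bdB koszul_bdK subr0 subrr.
by move=> /apply_diff0/(_ A)[x xE]; exists x; rewrite -xE !ffunE.
Qed.

End Comparison.

(** * Syzygy degrees as simplicial homology *)
Section Toric.
Variables (k : fieldType) (m : nat) (d : 'I_m -> nat).
Local Notation R := {mpoly k[m]}.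

Definition toric_map (p : R) : {poly k} := mmap (@polyC k) (fun i => 'X^(d i)) p.
HB.instance Definition _ := GRing.RMorphism.copy toric_map toric_map.

Lemma toric_mapX i : toric_map 'X_i = 'X^(d i).
Proof. by rewrite /toric_map mmapX mmap1U. Qed.

Lemma toric_mapC c : toric_map c%:MP = c%:P.
Proof. by rewrite /toric_map mmapC. Qed.

Lemma mmap1_wdeg mu : mmap1 (fun i => 'X^(d i)) mu = 'X^(wdeg d mu) :> {poly k}.
Proof.
rewrite /mmap1 /wdeg -prodrXr; apply: eq_bigr => i _.
by rewrite -exprM mulnC.
Qed.

Lemma toric_mapXmu mu : toric_map 'X_[mu] = 'X^(wdeg d mu).
Proof. by rewrite /toric_map mmapX mmap1_wdeg. Qed.

Lemma coef_toric_map p s :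
  (toric_map p)`_s = \sum_(mu <- msupp p) p@_mu * (s == wdeg d mu)%:R.
Proof.
rewrite /toric_map /mmap coef_sum; apply: eq_bigr => mu _.
by rewrite mmap1_wdeg coefCM coefXn.
Qed.

Lemma toric_map_support p s : (toric_map p)`_s != 0 -> generated d [set: 'I_m] s.
Proof.
rewrite coef_toric_map => nz.
have [mu /eqP sE] : exists mu, s == wdeg d mu.
  apply: contrapT => nex; move: nz; rewrite big1 ?eqxx // => mu _.
  by case: eqP => [sE|_]; rewrite ?mulr0 //; case: nex; exists mu; apply/eqP.
exists mu; rewrite sE /wdeg; apply: eq_bigl => i; by rewrite inE.
Qed.

(** A homogeneous polynomial is mapped to a monomial, whose coefficient is thus the
    only obstruction to membership in the toric ideal. *)
Lemma toric_map_homogeneous p s : (forall mu, mu \in msupp p -> wdeg d mu = s) ->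
  (toric_map p)`_s = 0 -> toric_map p = 0.
Proof.
move=> ps p0; apply/polyP => t; rewrite coef0.
have [->//|ts] := eqVneq t s.
rewrite coef_toric_map big_seq big1 // => mu /ps ->.
by rewrite (negbTE ts) mulr0.
Qed.

End Toric.

Section Ends.
Variables (k : fieldType) (m : nat) (d : 'I_m -> nat) (C : free_sequence k m).
Hypothesis resC : is_minimal_graded_resolution d C.
Local Notation R := {mpoly k[m]}.
Local Notation b := (betti C).
Local Notation diff i := (differential C i).
Local Notation koszul_chain := (koszul_chain C).
Implicit Types (A B : {set 'I_m}).

Definition twist_count i n := #|[pred c : 'I_(b i) | twist c == n]|.

Lemma koszul_bd_in_degree0 i (w : koszul_chain i) : in_degree 0 w -> koszul_bd w = 0.
Proof.
move=> w0; apply/ffunP => A; rewrite !ffunE big1 // => j jA.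
by rewrite w0 ?scaler0 // cards_eq0; apply/set0Pn; exists j; rewrite setU11.
Qed.

(** In Koszul degree 0, boundaries and N_i consist of the chains without constant terms.
    The constant terms of a homogeneous chain sit on the basis elements of its degree. *)
Lemma rel_homology0_dim n i r :
  indep_mod (@const_scale k m _) (@rel_cycle k m d C n 0 i) (@rel_boundary k m C i) r <->
  (r <= twist_count i n)%N.
Proof.
pose P : pred 'I_(b i) := fun c => twist c == n.
have rE : (r <= twist_count i n)%N =
    (r + \rank (0%R : 'M[k]_#|'I_(b i)|) <= \rank (coord_mx k P))%N.
  by rewrite mxrank0 addn0 rank_coord.
rewrite rE -indep_mod_rowspace ?sub0mx //.
split.
  apply: (indep_mod_transfer (rel := fun w v =>
    in_degree 0 w /\ v = fin_row (fun c => (w set0 0 c)@_0%MM))).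
  - split; first by move=> A _; rewrite ffunE.
    by apply/rowP => j; rewrite !mxE ffunE mxE mcoeff0.
  - move=> u u' v v' [uq ->] [vq ->]; split.
      by move=> A Aq; rewrite ffunE uq // vq // addr0.
    by apply/rowP => j; rewrite !mxE ffunE mxE mcoeffD.
  - move=> c u u' [uq ->]; split.
      by move=> A Aq; rewrite ffunE uq // scaler0.
    by apply/rowP => j; rewrite !mxE ffunE mxE rmorphM /= mcoeffC eqxx mulr1.
  - move=> w [wn wq _]; eexists; last by split.
    apply/fin_row_sub_coord => c; rewrite /P => nc; apply/eqP; rewrite mcoeff_eq0.
    apply: contra nc => /wn <-; rewrite /wdeg /weight big_set0 addn0.
    by rewrite big1 // => j _; rewrite mnm0E.
  - move=> w v [wq ->]; rewrite submx0 => /eqP v0.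
    exists (contraction w) => A; exists 0; rewrite mul0mx koszul_bd_contraction ?subrr //.
      exact: koszul_bd_in_degree0.
    move=> c; move: c; apply: (@fin_row_inj k); rewrite v0.
    by apply/rowP => j; rewrite !mxE.
apply: (indep_mod_transfer (rel := fun (v : 'rV[k]_#|'I_(b i)|) (w : koszul_chain i) =>
    w = [ffun A : {set 'I_m} => if A == set0 then \row_c (v 0 (enum_rank c))%:MP else 0])).
- by apply/ffunP => A; rewrite !ffunE; case: ifP => // _; apply/rowP => j; rewrite !mxE mpolyC0.
- move=> u u' v v' -> ->; apply/ffunP => A; rewrite !ffunE; case: ifP => _; last by rewrite addr0.
  by apply/rowP => j; rewrite !mxE mpolyCD.
- move=> c v v' ->; apply/ffunP => A; rewrite !ffunE; case: ifP => _; last by rewrite scaler0.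
  by apply/rowP => j; rewrite !mxE mpolyCM.
- move=> v; rewrite [v]fin_rowE => /fin_row_sub_coord vP; eexists; last by [].
  set w : koszul_chain i := [ffun _ => _].
  have wq : in_degree 0 w.
    by move=> A; rewrite ffunE cards_eq0 => /negbTE ->.
  split=> //.
    move=> A c mu; rewrite ffunE; case: eqP => [->|_]; last by rewrite mxE msupp0.
    rewrite mxE msuppC; case: ifP => // vc; rewrite inE => /eqP ->.
    have -> : twist c = n.
      apply/eqP; move: vc; apply: contraFT => nc.
      by rewrite mxE enum_rankK -[X in X == 0]/(_ ) (vP c nc).
    by rewrite /weight big_set0 addn0 /wdeg big1 // => j _; rewrite mnm0E.
  by move=> A; exists 0; rewrite mul0mx koszul_bd_in_degree0 // ffunE.
move=> v w -> [a aE]; rewrite submx0; apply/eqP/rowP => j.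
have [u uE] := aE set0.
have := diff_minimal resC u (enum_val j); rewrite -uE mxE [X in _ + X]mxE mcoeffB.
rewrite koszul_bd_const subr0 ffunE eqxx mxE enum_valK mcoeffC eqxx mulr1 => ->.
by rewrite mxE.
Qed.

(** The squarefree divisor complex of n. *)
Definition semigroup_complex n : pred {set 'I_m} := fun A =>
  (weight d A <= n)%N && `[< generated d [set: 'I_m] (n - weight d A) >].

Lemma betti0 : b 0 = 1%N. Proof. by case: resC => -[]. Qed.

Lemma twist0 (c : 'I_(b 0)) : twist c = 0%N. Proof. by case: resC => -[]. Qed.

Definition col0 : 'I_(b 0) := cast_ord (esym betti0) ord0.

Lemma col0E (c : 'I_(b 0)) : c = col0.
Proof.
apply/val_inj => /=; move: (c : nat) (ltn_ord c) => x; rewrite betti0.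
by rewrite ltnS leqn0 => /eqP.
Qed.

Lemma im_diff0 (v : 'rV[R]_(b 0)) :
  (exists u, v = u *m diff 0) <-> toric_map d (v 0 col0) = 0.
Proof.
case: resC => _ _ H _ _; rewrite H; split=> [/(_ col0)//|v0 j].
by rewrite (col0E j).
Qed.

(** The image of a chain over F_0 in the Koszul complex of k[S]. In degree n the latter is
    the chain complex of [semigroup_complex], since each S-graded part of k[S] has
    dimension at most 1. *)
Definition evaluation n (w : koszul_chain 0) : {ffun {set 'I_m} -> k^o} :=
  [ffun A => if (weight d A <= n)%N then
    (toric_map d (w A 0 col0))`_(n - weight d A) else 0].

Lemma evaluationD n u v : evaluation n (u + v) = evaluation n u + evaluation n v.
Proof.
apply/ffunP => A; rewrite !ffunE mxE rmorphD coefD; case: ifP => // _.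
by rewrite addr0.
Qed.

Lemma evaluationZ n c u A : evaluation n (const_scale c u) A = c * evaluation n u A.
Proof.
rewrite !ffunE mxE rmorphM /= toric_mapC coefCM; case: ifP => // _.
by rewrite mulr0.
Qed.

Lemma evaluationB n u v : evaluation n (u - v) = evaluation n u - evaluation n v.
Proof.
apply/ffunP => A; rewrite !ffunE !mxE rmorphB coefB; case: ifP => // _.
by rewrite subr0.
Qed.

Lemma boundary_evaluation n w : boundary (evaluation n w) = evaluation n (koszul_bd w).
Proof.
apply/ffunP => A; rewrite boundaryE !ffunE summxE rmorph_sum coef_sum.
case: leqP => wA; last first.
  rewrite big1 // => j jA; rewrite ffunE weightU1 // ifF ?mulr0 //.
  by apply/negbTE; rewrite -ltnNge; lia.
apply: eq_bigr => j jA; rewrite ffunE weightU1 // mxE !rmorphM /=.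
rewrite rmorphXn /= rmorphN1 toric_mapX -mulrA.
have -> : (-1 : {poly k}) ^+ #|[set a in A | (a < j)%N]| = (face_sign k A j)%:P.
  by rewrite /face_sign rmorphXn /= rmorphN1.
rewrite coefCM coefXnM; congr (_ * _); rewrite ltnNge leq_subRL // addnC.
by case: leqP => //= le; rewrite -subnDA addnC.
Qed.

Lemma evaluation_support n w A : ~~ semigroup_complex n A -> evaluation n w A = 0.
Proof.
rewrite ffunE /semigroup_complex; case: leqP => //= _ /asboolPn nS.
by apply/eqP; apply: contrapT => /negP nz; apply: nS; exact: toric_map_support nz.
Qed.

Lemma evaluation_im n (w : koszul_chain 0) A :
  (exists u, w A = u *m diff 0) -> evaluation n w A = 0.
Proof. by move=> /im_diff0 w0; rewrite ffunE w0 coef0 if_same. Qed.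

Lemma evaluation_eq0 n (w : koszul_chain 0) : homogeneous d n w -> evaluation n w = 0 ->
  forall A, exists u, w A = u *m diff 0.
Proof.
move=> wn w0 A; apply/im_diff0.
have H mu : mu \in msupp (w A 0 col0) -> (wdeg d mu + weight d A)%N = n.
  by move=> /wn <-; rewrite twist0 addn0.
have [wA|wA] := leqP (weight d A) n.
  apply: (@toric_map_homogeneous _ _ _ _ (n - weight d A)).
    by move=> mu /H <-; rewrite addnK.
  by have := congr1 (fun u : {ffun {set 'I_m} -> k^o} => u A) w0; rewrite !ffunE wA.
have -> : w A 0 col0 = 0; last by rewrite rmorph0.
apply: msuppnil0; case E : (msupp _) => [//|mu s].
by have := H mu; rewrite E mem_head => /(_ isT) En; move: wA; rewrite -En ltnNge leq_addl.
Qed.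

(** A representation of n - weight A by the generators is the exponent of a monomial of
    that degree. *)
Lemma evaluation_lift n (u : {ffun {set 'I_m} -> k^o}) :
  (forall A, ~~ semigroup_complex n A -> u A = 0) ->
  exists w : koszul_chain 0, [/\ homogeneous d n w, evaluation n w = u &
    forall A, u A = 0 -> w A = 0].
Proof.
move=> us.
have ex A : exists mu : 'X_{1..m}, semigroup_complex n A ->
    (wdeg d mu + weight d A)%N = n.
  have [/andP[wA /asboolP[a aE]]|nS] := boolP (semigroup_complex n A); last by exists 0%MM.
  exists [multinom a i | i < m] => _; rewrite -[RHS](subnK wA) aE; congr (_ + _)%N.
  rewrite /wdeg; apply: eq_big => [i|i _]; first by rewrite inE.
  by rewrite mnmE.
have /fin_all_exists[mon monE] := ex.
exists [ffun A => \row_c ((u A)%:MP * 'X_[mon A])]; split.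
- move=> A c mu; rewrite ffunE mxE mul_mpolyC => /[dup] /msuppZ_le.
  rewrite msuppX inE => /eqP ->; rewrite twist0 addn0.
  have [/monE//|/us ->] := boolP (semigroup_complex n A).
  by rewrite scale0r msupp0.
- apply/ffunP => A; rewrite !ffunE mxE rmorphM /= toric_mapC.
  have [nS|/us ->] := boolP (semigroup_complex n A); last first.
    by rewrite mul0r coef0 if_same.
  have [wA _] := andP nS; rewrite wA coefCM toric_mapXmu coefXn -[X in (X - _)%N](monE A nS).
  by rewrite addnK eqxx mulr1.
by move=> A uA; apply/rowP => c; rewrite ffunE uA !mxE mpolyC0 mul0r.
Qed.

Lemma homogeneousD n i (u v : koszul_chain i) : homogeneous d n u -> homogeneous d n v ->
  homogeneous d n (u + v).
Proof.
move=> un vn A c mu; rewrite ffunE mxE => /msuppD_le; rewrite mem_cat.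
by case/orP => [/un|/vn].
Qed.

Lemma homogeneousB n i (u v : koszul_chain i) : homogeneous d n u -> homogeneous d n v ->
  homogeneous d n (u - v).
Proof.
move=> un vn A c mu; rewrite !ffunE !mxE => /msuppB_le; rewrite mem_cat.
by case/orP => [/un|/vn].
Qed.

Lemma homogeneousZ n i (u : koszul_chain i) c :
  homogeneous d n u -> homogeneous d n (const_scale c u).
Proof.
by move=> un A a mu; rewrite ffunE mxE mul_mpolyC => /msuppZ_le/un.
Qed.

Lemma homogeneous0 n i : homogeneous d n (0 : koszul_chain i).
Proof. by move=> A c mu; rewrite ffunE mxE msupp0. Qed.

Lemma is_complex_semigroup n : is_complex (semigroup_complex n).
Proof.
move=> j A jA /andP[]; rewrite weightU1 // => wA /asboolP[a aE].
apply/andP; split; first by lia.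
apply/asboolP; exists (fun i => a i + (i == j))%N.
rewrite (_ : n - weight d A = n - (d j + weight d A) + d j)%N; last by lia.
rewrite aE; under [in RHS]eq_bigr do rewrite mulnDl.
rewrite big_split /=; congr (_ + _)%N; rewrite (bigD1 j) ?inE //= eqxx mul1n big1 ?addn0 //.
by move=> i /andP[_ /negbTE ->].
Qed.

(** F_0 / N_0 is k[S], whose Koszul complex in degree n is that of [semigroup_complex]. *)
Lemma rel_homology_simplicial n q r :
  indep_mod (@const_scale k m _) (@rel_cycle k m d C n q 0) (@rel_boundary k m C 0) r <->
  (r <= homology_dim k (semigroup_complex n) q)%N.
Proof.
have BZ := boundaries_cycles k q (@is_complex_semigroup n).
rewrite leq_subRL ?mxrankS // addnC -indep_mod_rowspace //.
split.
  apply: (indep_mod_transfer (rel := fun w v =>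
    [/\ homogeneous d n w, in_degree q w & v = @fin_row k _ (evaluation n w)])).
  - split; first exact: homogeneous0.
      by move=> A _; rewrite ffunE.
    by apply/rowP => j; rewrite !mxE ffunE ffunE mxE rmorph0 coef0 if_same.
  - move=> u u' v v' [un uq ->] [vn vq ->]; split; first exact: homogeneousD.
      by move=> A Aq; rewrite ffunE uq // vq // addr0.
    by rewrite evaluationD; apply/rowP => j; rewrite !mxE ffunE [in RHS]ffunE [in RHS]ffunE.
  - move=> c u u' [un uq ->]; split; first exact: homogeneousZ.
      by move=> A Aq; rewrite ffunE uq // scaler0.
    by apply/rowP => j; rewrite !mxE evaluationZ.
  - move=> w [wn wq w0]; eexists; last by split.
    apply/fin_row_cycle; split=> [A|].
      rewrite /cell negb_and => /orP[/evaluation_support//|Aq].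
      by rewrite ffunE wq // mxE rmorph0 coef0 if_same.
    by rewrite boundary_evaluation; apply/ffunP => A; rewrite evaluation_im // ffunE.
  - move=> w v [wn wq ->] /fin_row_boundary[u us wE].
    have [A|a [an aE _]] := @evaluation_lift n u.
      by move=> nS; apply: us; rewrite /cell negb_and nS.
    have E : evaluation n (w - koszul_bd a) = 0.
      by rewrite evaluationB -boundary_evaluation aE wE subrr.
    have hom : homogeneous d n (w - koszul_bd a).
      by apply: homogeneousB => //; exact: koszul_bd_homogeneous.
    exists a => A; have [x xE] := evaluation_eq0 hom E A.
    by exists x; rewrite -xE !ffunE.
apply: (indep_mod_transfer (rel := fun v w =>
    [/\ homogeneous d n w, in_degree q w & v = @fin_row k _ (evaluation n w)])).
- split; first exact: homogeneous0.
    by move=> A _; rewrite ffunE.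
  by apply/rowP => j; rewrite !mxE ffunE ffunE mxE rmorph0 coef0 if_same.
- move=> u' u v' v [un uq ->] [vn vq ->]; split; first exact: homogeneousD.
    by move=> A Aq; rewrite ffunE uq // vq // addr0.
  by rewrite evaluationD; apply/rowP => j; rewrite !mxE ffunE [in RHS]ffunE [in RHS]ffunE.
- move=> c u' u [un uq ->]; split; first exact: homogeneousZ.
    by move=> A Aq; rewrite ffunE uq // scaler0.
  by apply/rowP => j; rewrite !mxE evaluationZ.
- move=> v0; pose v : {ffun {set 'I_m} -> k^o} := [ffun A => v0 0 (enum_rank A)].
  have -> : v0 = @fin_row k _ v.
    by rewrite {1}[v0]fin_rowE; apply: eq_fin_row => A; rewrite ffunE.
  move=> /fin_row_cycle[vs v1].
  have [A nS|w [wn wE w0]] := @evaluation_lift n v.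
    by apply: vs; rewrite /cell negb_and nS.
  have wq : in_degree q w.
    by move=> A Aq; apply: w0; apply: vs; rewrite /cell negb_and Aq orbT.
  exists w; last by rewrite wE.
  split=> //; apply: (@evaluation_eq0 n); first exact: koszul_bd_homogeneous.
  by rewrite -boundary_evaluation wE.
move=> v w [wn wq ->] [a aE]; apply/fin_row_boundary.
exists [ffun A : {set 'I_m} => if #|A| == q.+1 then evaluation n a A else 0].
  move=> A; rewrite /cell negb_and ffunE => /orP[nS|/negbTE ->//].
  by rewrite evaluation_support // if_same.
apply/ffunP => A; rewrite boundaryE.
under eq_bigr => j jA do rewrite ffunE cardsU1 jA add1n eqSS.
have [Aq|Aq] := boolP (#|A| == q); last first.
  rewrite big1 => [|j _]; last by rewrite mulr0.
  by rewrite ffunE wq // mxE rmorph0 coef0 if_same.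
rewrite -boundaryE boundary_evaluation; apply/eqP; rewrite -subr_eq0; apply/eqP.
have := @evaluation_im n (w - koszul_bd a) A; rewrite evaluationB !ffunE; apply.
by have [x xE] := aE A; exists x; rewrite -xE !ffunE.
Qed.

(** Both numbers are dimensions of relative Koszul homology: in degree i over k[S] and, after
    i dimension shifts, in degree 0 over the i-th syzygy module. *)
Theorem twist_count_homology n i :
  twist_count i n = homology_dim k (semigroup_complex n) i.
Proof.
have shift q j r : indep_mod (@const_scale k m _) (@rel_cycle k m d C n (j + q)%N 0)
      (@rel_boundary k m C 0) r <->
    indep_mod (@const_scale k m _) (@rel_cycle k m d C n q j) (@rel_boundary k m C j) r.
  elim: j q => [|j IH] q; first by [].
  have := IH q.+1; rewrite addnS => E; exact: iff_trans E (dimension_shift resC _ _ _ _).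
have le r : (r <= twist_count i n)%N = (r <= homology_dim k (semigroup_complex n) i)%N.
  apply/idP/idP => /=.
    by move=> /rel_homology0_dim/shift; rewrite addn0 => /rel_homology_simplicial.
  by move=> /rel_homology_simplicial; rewrite -{1}[i]addn0 => /shift/rel_homology0_dim.
by apply/eqP; rewrite eqn_leq le leqnn -le leqnn.
Qed.

End Ends.

(** * Moments of a polynomial with a zero at 1 *)
Section Moments.
Variable R : fieldType.
Implicit Types (psi p q : {poly R}).

Definition moment psi p : R := \sum_(i < size p) p`_i * psi.[i%:R].

Lemma momentE psi p n : (size p <= n)%N ->
  moment psi p = \sum_(i < n) p`_i * psi.[i%:R].
Proof.
move=> pn; rewrite /moment (big_ord_widen _ (fun i => p`_i * psi.[i%:R]) pn).
rewrite big_mkcond; apply: eq_bigr => i _; case: ltnP => // pi.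
by rewrite nth_default // mul0r.
Qed.

Definition shift_diff (a : nat) psi := psi - (psi \Po ('X + a%:R%:P)).

(** Multiplication by 1 - X^a is adjoint to a finite difference. *)
Lemma moment_mul psi p a :
  moment psi ((1 - 'X^a) * p) = moment (shift_diff a psi) p.
Proof.
pose n := (size p + a)%N.
have s1 : (size ((1 - 'X^a) * p)%R <= n)%N.
  rewrite mulrBl mul1r (leq_trans (size_polyD _ _)) // geq_max size_polyN leq_addr /=.
  by rewrite (leq_trans (size_polyMleq _ _)) // size_polyXn /n; lia.
rewrite (momentE _ s1) (@momentE _ p n) ?leq_addr //.
under eq_bigr do rewrite mulrBl mul1r coefB coefXnM mulrBl.
under [RHS]eq_bigr do rewrite hornerD hornerN horner_comp hornerD hornerX hornerC mulrBr -natrD.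
rewrite !sumrB; congr (_ - _).
rewrite -(big_mkord xpredT (fun i => (if (i < a)%N then 0 else p`_(i - a)) * psi.[i%:R])).
rewrite -(big_mkord xpredT (fun i => p`_i * psi.[(i + a)%:R])).
rewrite (@big_cat_nat _ _ _ a) ?leq_addl //= big_nat_cond big1 ?add0r;
  last by move=> i /andP[/andP[_ ->]]; rewrite mul0r.
rewrite -{1}[a]add0n big_addn addnK.
under eq_bigr do rewrite ltnNge leq_addl /= addnK.
rewrite [RHS](@big_cat_nat _ _ _ (size p)) ?leq_addr //=.
rewrite [X in _ = _ + X]big_nat_cond [X in _ = _ + X]big1 ?addr0 //.
by move=> i /andP[/andP[pi _] _]; rewrite nth_default ?mul0r.
Qed.

Lemma shift_diff_mulX a psi :
  shift_diff a ('X * psi) = 'X * shift_diff a psi - a%:R%:P * (psi \Po ('X + a%:R%:P)).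
Proof. by rewrite /shift_diff comp_polyM comp_polyX; ring. Qed.

Lemma size_comp_shift a psi : size (psi \Po ('X + a%:R%:P)) = size psi.
Proof. by rewrite size_comp_poly2 // size_XaddC. Qed.

(** A finite difference lowers the degree and multiplies the leading coefficient like a
    derivative. The induction removes the constant term of psi and divides by X. *)
Lemma shift_diffP a n psi : (size psi <= n.+1)%N ->
  (size (shift_diff a psi) <= n)%N /\
  (if n is n'.+1 then (shift_diff a psi)`_n' = - (n'.+1%:R * a%:R * psi`_n) else True).
Proof.
elim: n psi => [|n IH] psi sz.
  rewrite /shift_diff (size1_polyC sz) comp_polyC subrr size_poly0; split=> //.
have [psi' [c psiE]] : exists psi' c, psi = 'X * psi' + c%:P.
  elim/poly_ind: psi sz => [|p c _] _; last by exists p, c; rewrite mulrC.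
  by exists 0, 0; rewrite mulr0 add0r polyC0.
have sz' : (size psi' <= n.+1)%N.
  move: sz; rewrite psiE mulrC -cons_poly_def size_cons_poly.
  case: ifP => // /andP[/nilP p0 _] _.
  by rewrite (_ : psi' = 0) ?size_poly0 //; apply/eqP; rewrite -size_poly_eq0 p0.
have [sd cd] := IH _ sz'.
have dE : shift_diff a psi = 'X * shift_diff a psi' - a%:R%:P * (psi' \Po ('X + a%:R%:P)).
  by rewrite psiE -shift_diff_mulX /shift_diff comp_polyD comp_polyC; ring.
have coefn : (psi' \Po ('X + a%:R%:P))`_n = psi'`_n.
  apply/eqP; rewrite eq_sym -subr_eq0 -coefB; apply/eqP.
  by rewrite nth_default.
split.
  rewrite dE (leq_trans (size_polyD _ _)) // geq_max size_polyN; apply/andP; split.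
    rewrite mulrC (leq_trans (size_polyMleq _ _)) // size_polyX; lia.
  by rewrite mul_polyC (leq_trans (size_scale_leq _ _)) // size_comp_shift.
have -> : psi`_n.+1 = psi'`_n.
  by rewrite psiE coefD coefC /= addr0 coefXM.
rewrite dE coefB coefCM coefn coefXM.
case: (n) cd => [_|n' ->] /=; first by rewrite mul1r sub0r.
by rewrite -[n'.+2]addn1 natrD; ring.
Qed.

(** After as many differences as the degree of psi only a constant is left, and the moment
    of a constant is a multiple of the value at 1. *)
Lemma moment_prod (s : seq nat) psi p : (size psi <= (size s).+1)%N ->
  moment psi (\prod_(a <- s) (1 - 'X^a) * p) =
  (-1) ^+ size s * (size s)`!%:R * (\prod_(a <- s) a%:R) * psi`_(size s) * p.[1].
Proof.
elim: s psi => [|a s IH] psi sz.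
  rewrite !big_nil mul1r /moment (size1_polyC sz) horner_coef /= mulr_sumr.
  apply: eq_bigr => i _; rewrite hornerC coefC /= expr1n fact0; ring.
have [sd cd] := shift_diffP a sz.
rewrite !big_cons -mulrA moment_mul IH //= cd exprS factS natrM; ring.
Qed.

End Moments.

(** * Euler characteristic, symmetry, and duality of syzygy degrees *)
Lemma eq_homology_dim (k : fieldType) m (D D' : pred {set 'I_m}) i :
  D =1 D' -> homology_dim k D i = homology_dim k D' i.
Proof. by move=> /funext ->. Qed.

(** The ranks of the boundaries cancel in pairs. *)
Lemma euler_homology (R : pzRingType) (k : fieldType) m (D : pred {set 'I_m}) : is_complex D ->
  \sum_(i < m.+1) (-1) ^+ i * (homology_dim k D i)%:R =
  \sum_(A | D A) (-1) ^+ #|A| :> R.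
Proof.
move=> cD.
have -> : \sum_(A | D A) (-1) ^+ #|A| = \sum_(i < m.+1) (-1) ^+ i * (#|cell D i|)%:R :> R.
  rewrite (partition_big (fun A : {set 'I_m} => inord #|A| : 'I_m.+1) xpredT) //=.
  apply: eq_bigr => i _; rewrite mulr_natr -sumr_const; apply: eq_big => A.
    rewrite [RHS]unfold_in /cell -(inj_eq val_inj) /= inordK // ltnS.
    by rewrite -[X in (_ <= X)%N](card_ord m) max_card.
  by move=> /andP[_ /eqP <-]; rewrite inordK // ltnS -[X in (_ <= X)%N](card_ord m) max_card.
have -> : \sum_(i < m.+1) (-1) ^+ i * (#|cell D i|)%:R =
    \sum_(i < m.+1) (-1) ^+ i * (homology_dim k D i)%:R +
    \sum_(i < m.+1) ((-1) ^+ i * (boundary_rank k D i)%:R -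
      (-1) ^+ i.+1 * (boundary_rank k D i.+1)%:R) :> R.
  rewrite -big_split; apply: eq_bigr => i _ /=.
  by rewrite -(homology_dimE k i cD) !natrD !mulrDr exprS mulN1r mulNr opprK addrA.
rewrite -(big_mkord xpredT (fun i => (-1) ^+ i * (boundary_rank k D i)%:R -
  (-1) ^+ i.+1 * (boundary_rank k D i.+1)%:R)).
rewrite -[X in _ + X]opprK -sumrN.
under [X in _ = _ - X]eq_bigr do rewrite opprB.
rewrite (telescope_sumr (fun i => (-1) ^+ i * (boundary_rank k D i)%:R)) //.
by rewrite boundary_rank0 boundary_rank_over // !mulr0 subrr subr0.
Qed.

Section SymmetricSemigroup.
Variables (m : nat) (d : 'I_m -> nat).
Hypothesis (d_gt0 : forall i, (0 < d i)%N).
Implicit Types (A B : {set 'I_m}).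
Local Notation S := (in_semigroup d).

Lemma in_semigroup_nat (n : nat) : S n%:Z <-> generated d [set: 'I_m] n.
Proof. by split=> [[s gs /eqP]|gs]; [rewrite eqz_nat => /eqP ->|exists n]. Qed.

Lemma in_semigroup_ge0 (z : int) : S z -> 0 <= z.
Proof. by case=> s _ ->. Qed.

Lemma semigroup_complexE n A :
  semigroup_complex d n A = `[< S (n%:Z - (weight d A)%:Z) >].
Proof.
apply/idP/asboolP => [/andP[wA /asboolP gA]|SA].
  by rewrite subzn //; apply/in_semigroup_nat.
have := in_semigroup_ge0 SA; rewrite subr_ge0 lez_nat => wA.
rewrite /semigroup_complex wA; apply/asboolP/in_semigroup_nat.
by rewrite -subzn.
Qed.

Lemma weightC A : (weight d A + weight d (~: A) = weight d setT)%N.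
Proof.
rewrite /weight (bigID (mem A) (mem setT)) /=; congr (_ + _)%N; apply: eq_bigl => i.
  by rewrite inE.
by rewrite !inE.
Qed.

Variables (F : int) (g : nat).
Hypothesis frob : is_Frobenius_number d F.
Hypothesis gE : g%:Z = F + (weight d setT)%:Z.

(** Above g all the differences n - weight A exceed the Frobenius number. *)
Lemma semigroup_complex_full n : (g < n)%N -> semigroup_complex d n =1 predT.
Proof.
move=> gn A; rewrite semigroup_complexE; apply/asboolP; apply: frob.2.
have := weightC A; lia.
Qed.

Hypothesis sym : forall n : int, (S n /\ ~ S (F - n)) \/ (~ S n /\ S (F - n)).

(** With g = F + weight of all generators, the condition on A in degree g - n is the image
    under z -> F - z of the condition on the complement of A in degree n. *)
Lemma semigroup_complex_dual n : (n <= g)%N ->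
  semigroup_complex d (g - n)%N =1 dual_complex (semigroup_complex d n).
Proof.
move=> ng A; rewrite /dual_complex !semigroup_complexE -asbool_neg; apply: asbool_equiv_eq.
have -> : n%:Z - (weight d (~: A))%:Z = F - ((g - n)%N%:Z - (weight d A)%:Z).
  have := weightC A; lia.
by have [[]|[]] := sym ((g - n)%N%:Z - (weight d A)%:Z); split.
Qed.

End SymmetricSemigroup.

Section TwistSymmetry.
Variables (k : fieldType) (m : nat) (d : 'I_m -> nat) (C : free_sequence k m).
Hypothesis resC : is_minimal_graded_resolution d C.
Variables (F : int) (g : nat).
Hypothesis frob : is_Frobenius_number d F.
Hypothesis gE : g%:Z = F + (weight d setT)%:Z.
Hypothesis sym : forall n : int, (in_semigroup d n /\ ~ in_semigroup d (F - n)) \/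
  (~ in_semigroup d n /\ in_semigroup d (F - n)).
Hypothesis m_gt0 : (0 < m)%N.
Local Notation T := (@twist_count k m C).

Lemma twist_count_over i n : (g < n)%N -> T i n = 0%N.
Proof.
move=> gn; rewrite (twist_count_homology resC).
rewrite (eq_homology_dim k i (semigroup_complex_full frob gE gn)).
exact: homology_dim_simplex.
Qed.

Lemma twist_count_top n : T m n = 0%N.
Proof.
by rewrite (twist_count_homology resC) homology_dim_top //; apply: is_complex_semigroup.
Qed.

(** Self-duality of the resolution, degree by degree. *)
Lemma twist_count_dual i p n : (i + p).+1 = m -> (n <= g)%N ->
  T i (g - n)%N = T p n.
Proof.
move=> ip ng; rewrite !(twist_count_homology resC).
rewrite (eq_homology_dim k i (semigroup_complex_dual gE sym ng)).
by apply: homology_dim_dual => //; apply: is_complex_semigroup.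
Qed.

Lemma twist_count0 n : T 0 n = (n == 0)%N.
Proof.
case: resC => -[b1 t0] _ _ _ _; rewrite /twist_count.
have -> : #|[pred c : 'I_(betti C 0) | twist c == n]| = #|[pred c : 'I_(betti C 0) | n == 0%N]|.
  by apply: eq_card => c; rewrite !inE t0 eq_sym.
by case: eqP => _; [rewrite cardT size_enum_ord|rewrite eq_card0].
Qed.

Lemma twist_le i (c : 'I_(betti C i)) : (twist c <= g)%N.
Proof.
rewrite leqNgt; apply/negP => /(twist_count_over i)/eqP; rewrite -leqn0 leqNgt => /negP[].
by apply/card_gt0P; exists c; rewrite inE.
Qed.

Lemma sum_twist_count (V : nmodType) i (f : nat -> V) :
  \sum_(n < g.+1) f n *+ T i n = \sum_c f (@twist _ _ C i c).
Proof.
rewrite [RHS](partition_big (fun c : 'I_(betti C i) => inord (twist c) : 'I_g.+1) xpredT) //=.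
apply: eq_bigr => n _; rewrite /twist_count -sumr_const; apply: eq_big => c.
  by rewrite inE -(inj_eq val_inj) /= inordK // ltnS twist_le.
by rewrite inE => /eqP ->.
Qed.

End TwistSymmetry.

(** * The numerator of the Hilbert series *)
Section HilbertNumerator.
Variables (R : fieldType) (m : nat) (d : 'I_m.+1 -> nat).
Implicit Types (A B : {set 'I_m.+1}).
Variables (F : int) (g : nat).
Hypothesis frob : is_Frobenius_number d F.
Hypothesis gE : g%:Z = F + (weight d setT)%:Z.

(** The coefficient of t^n in the product of the Hilbert series with all 1 - t^(d i). *)
Definition numerator_coef n : R := \sum_(A | semigroup_complex d n A) (-1) ^+ #|A|.

Lemma numerator_coef_over n : (g < n)%N -> numerator_coef n = 0.
Proof.
move=> gn; rewrite /numerator_coef (eq_bigl _ _ (semigroup_complex_full frob gE gn)).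
rewrite -(euler_homology R R) // big1 // => i _.
by rewrite homology_dim_simplex // mulr0.
Qed.

Definition numerator : {poly R} := \poly_(n < g.+1) numerator_coef n.

Lemma coef_numerator n : numerator`_n = numerator_coef n.
Proof. by rewrite coef_poly ltnS; case: leqP => // /numerator_coef_over ->. Qed.

Definition member (n : nat) : R := (`[< generated d [set: 'I_m.+1] n >])%:R.

(** This is F + 2 for nonnegative F; the absolute value covers F = -1. *)
Definition stable_bound := (absz F).+2.

Lemma member_large n : (stable_bound <= n.+1)%N -> member n = 1.
Proof.
rewrite /stable_bound => ln; rewrite /member; case: asboolP => // -[].
by apply/in_semigroup_nat; apply: frob.2; lia.
Qed.

(** This is (1 - t) H(S; t), a polynomial because membership in S is eventually constant. *)
Definition increments : {poly R} :=
  \poly_(n < stable_bound) (member n - if n is n'.+1 then member n' else 0).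

Lemma coef_increments n :
  increments`_n = member n - if n is n'.+1 then member n' else 0.
Proof.
rewrite coef_poly; case: ltnP => // le; case: n le => [|n] // le.
by rewrite !member_large ?subrr //; apply: leq_trans le _.
Qed.

(** Telescoping leaves the value of the membership far out, which is 1. *)
Lemma increments1 : increments.[1] = 1.
Proof.
rewrite (horner_coef_wide _ (size_poly _ _)).
under eq_bigr do rewrite coef_increments expr1n mulr1.
rewrite /stable_bound big_ord_recl subr0.
under eq_bigr do rewrite /= /bump /= add1n.
rewrite -(big_mkord xpredT (fun i => member i.+1 - member i)) telescope_sumr //.
by rewrite addrC subrK member_large.
Qed.

Lemma prod_one_sub (s : 'I_m.+1 -> nat) :
  \prod_i (1 - 'X^(s i)) = \sum_(A : {set 'I_m.+1}) (-1) ^+ #|A| * 'X^(weight s A) :> {poly R}.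
Proof.
under eq_bigr do rewrite addrC.
rewrite bigA_distr; apply: eq_bigr => A _.
rewrite /weight -prodrXr -prodr_const -big_split /= [RHS]big_mkcond.
by apply: eq_bigr => i _; rewrite mulN1r.
Qed.

Lemma numerator_factor :
  (1 - 'X) * numerator = \prod_i (1 - 'X^(d i)) * increments.
Proof.
apply/polyP => n; rewrite mulrBl mul1r coefB coefXM !coef_numerator.
have -> : (if (n == 0)%N then 0 else numerator_coef n.-1) =
    \sum_(A : {set 'I_m.+1}) (-1) ^+ #|A| *
     (if (weight d A < n)%N then member (n.-1 - weight d A) else 0).
  case: n => [|n] /=.
    by rewrite big1 // => A _; rewrite mulr0.
  rewrite /numerator_coef big_mkcond; apply: eq_bigr => A _.
  rewrite /semigroup_complex ltnS /member; case: leqP => _ /=; last by rewrite mulr0.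
  by case: ifP => _; rewrite ?mulr1 ?mulr0.
rewrite /numerator_coef big_mkcond -sumrB prod_one_sub mulr_suml coef_sum.
apply: eq_bigr => A _; rewrite -mulrA -(rmorphN1 (@polyC R)) -rmorphXn /= coefCM coefXnM.
rewrite coef_increments /semigroup_complex /member.
case: (leqP (weight d A) n) => wn /=; last first.
  by rewrite (leq_gtF (ltnW wn)) mulr0 subr0.
case E : (n - weight d A)%N => [|u].
  have -> : (weight d A < n)%N = false by lia.
  by rewrite mulr0; case: ifP => _; rewrite !subr0 ?mulr1 ?mulr0.
have -> : (weight d A < n)%N by lia.
have -> : (n.-1 - weight d A)%N = u by lia.
by case: ifP => _; rewrite mulrBr ?mulr1 ?mulr0.
Qed.

(** One of the m + 1 factors 1 - X^(d i) is divided by 1 - X, which leaves the value d i at 1.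
    The others are the m differences that reduce psi to a multiple of its leading coefficient. *)
Lemma moment_numerator (psi : {poly R}) : (size psi <= m.+1)%N ->
  \sum_(n < g.+1) numerator_coef n * psi.[n%:R] =
  (-1) ^+ m * m`!%:R * (\prod_i (d i)%:R) * psi`_m.
Proof.
move=> sz; pose s := [seq d (lift ord0 i) | i <- enum 'I_m].
have ss : size s = m by rewrite size_map size_enum_ord.
have prods (V : comRingType) (f : nat -> V) :
    \prod_i f (d i) = f (d ord0) * \prod_(a <- s) f a.
  by rewrite big_ord_recl big_map big_enum.
(* h is the quotient of 1 - X^(d 0) by 1 - X. *)
pose h : {poly R} := \sum_(i < d ord0) 'X^i.
have hE : 1 - 'X^(d ord0) = (1 - 'X) * h.
  by rewrite -opprB subrX1 -mulNr opprB.
have numE : numerator = \prod_(a <- s) (1 - 'X^a) * (h * increments).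
  have X1 : (1 - 'X : {poly R}) != 0.
    by rewrite -opprB oppr_eq0 polyXsubC_eq0.
  apply: (mulfI X1); rewrite numerator_factor (prods _ (fun a => 1 - 'X^a)) hE; ring.
have -> : \sum_(n < g.+1) numerator_coef n * psi.[n%:R] = moment psi numerator.
  rewrite (momentE psi (size_poly _ _)); apply: eq_bigr => n _.
  by rewrite coef_numerator.
rewrite numE moment_prod ss // hornerM increments1 mulr1.
have -> : h.[1] = (d ord0)%:R.
  rewrite horner_sum -[in RHS](card_ord (d ord0)) -sum1_card natr_sum.
  by apply: eq_bigr => i _; rewrite hornerXn expr1n.
rewrite (prods _ (fun a => a%:R)); ring.
Qed.

End HilbertNumerator.

(** * Moment identities and ranks of the syzygy matrices *)
Section ResolutionMoments.
Variables (k : fieldType) (d : 'I_6 -> nat) (C : free_sequence k 6).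
Hypothesis resC : is_minimal_graded_resolution d C.
Variables (F : int) (g : nat).
Hypothesis frob : is_Frobenius_number d F.
Hypothesis gE : g%:Z = F + (weight d setT)%:Z.
Hypothesis sym : forall n : int, (in_semigroup d n /\ ~ in_semigroup d (F - n)) \/
  (~ in_semigroup d n /\ in_semigroup d (F - n)).
Variable R : fieldType.
Local Notation T := (@twist_count k 6 C).

(** By self-duality and antisymmetry of psi the homological degrees i and 5 - i contribute
    equally, and degree 6 is empty. *)
Lemma resolution_moment (psi : {poly R}) : (size psi <= 6)%N ->
  (forall t, psi.[g%:R - t] = - psi.[t]) ->
  2 * (psi.[0] - \sum_c psi.[(@twist _ _ C 1 c)%:R] + \sum_c psi.[(@twist _ _ C 2 c)%:R])
  = - (120 * (\prod_i (d i)%:R) * psi`_5).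
Proof.
move=> sz anti.
pose s i : R := \sum_(n < g.+1) psi.[n%:R] *+ T i n.
have sE i : s i = \sum_c psi.[(@twist _ _ C i c)%:R].
  exact: (sum_twist_count resC frob gE isT i (fun n => psi.[n%:R])).
have s0 : s 0%N = psi.[0].
  rewrite /s big_ord_recl (twist_count0 resC) mulr1n big1 ?addr0 // => n _.
  by rewrite (twist_count0 resC).
have dual i p : (i + p = 5)%N -> s i = - s p.
  move=> ip; rewrite /s [LHS](reindex_inj rev_ord_inj) -sumrN; apply: eq_bigr => n _.
  have ng : (n <= g)%N by rewrite -ltnS.
  rewrite /= subSS (twist_count_dual resC gE sym (p := p)) ?ip // natrB // anti.
  by rewrite mulNrn.
have s6 : s 6%N = 0.
  by rewrite /s big1 // => n _; rewrite (twist_count_top resC).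
have coefE n : numerator_coef R d n = \sum_(i < 7) (-1) ^+ i * (T i n)%:R.
  rewrite /numerator_coef -(euler_homology R k); last exact: is_complex_semigroup.
  by apply: eq_bigr => i _; rewrite (twist_count_homology resC).
have sumE : \sum_(n < g.+1) numerator_coef R d n * psi.[n%:R] =
    \sum_(i < 7) (-1) ^+ i * s i.
  transitivity (\sum_(n < g.+1) \sum_(i < 7) (-1) ^+ i * (psi.[n%:R] *+ T i n)).
    apply: eq_bigr => n _; rewrite coefE mulr_suml; apply: eq_bigr => i _.
    by rewrite -mulrA mulr_natl.
  by rewrite exchange_big; apply: eq_bigr => i _; rewrite -mulr_sumr.
have altE : \sum_(i < 7) (-1) ^+ i * s i = 2 * (s 0%N - s 1%N + s 2%N).
  rewrite !big_ord_recl big_ord0 /= /bump /= s6 (dual 5%N 0%N) // (dual 4%N 1%N) //.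
  rewrite (dual 3%N 2%N) //; ring.
rewrite -sE -sE -s0 -altE -sumE (moment_numerator frob gE sz).
rewrite (_ : 5`! = 120)%N //; ring.
Qed.

End ResolutionMoments.

Section Ranks.
Variables (k : fieldType) (m : nat) (d : 'I_m -> nat) (C : free_sequence k m).
Hypothesis resC : is_minimal_graded_resolution d C.
Local Notation Rg := {mpoly k[m]}.
Local Notation b := (betti C).
Local Notation diff i := (differential C i).
Local Notation frac := {fraction Rg}.
Local Notation f c := (diff 0 c (col0 resC)).

(** Minimality: a basis element in the kernel would be in the next image, which has no
    constant terms. *)
Lemma basis_not_cycle i (c : 'I_(b i.+1)) : (delta_mx 0 c : 'rV_(b i.+1)) *m diff i != 0.
Proof.
apply/eqP => /(diff_exact resC)[w wE].
have := diff_minimal resC w c; rewrite -wE mxE !eqxx mcoeff1 eqxx => /eqP.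
by rewrite oner_eq0.
Qed.

Lemma betti_eq0 i : b i = 0%N -> b i.+1 = 0%N.
Proof.
move=> b0; apply/eqP; rewrite -leqn0 leqNgt; apply/negP => lt.
have /eqP[] := basis_not_cycle (Ordinal lt); apply/rowP => j.
by have := ltn_ord j; rewrite {2}b0.
Qed.

Lemma generator_neq0 (c : 'I_(b 1)) : f c != 0.
Proof.
apply: contra (basis_not_cycle c) => /eqP f0; apply/eqP/rowP => j.
by rewrite -rowE mxE (col0E resC j) f0 mxE.
Qed.

Local Notation toF := (@tofrac Rg).

(** The transpose of the second differential over the fraction field. Row vectors in its
    left kernel are the relations between the columns of that differential. *)
Definition syzygy_mx := fin_mx (fun (c : 'I_(b 1)) (r : 'I_(b 2)) => toF (diff 1 r c)).

(** The syzygy f_c' e_c - f_c e_c' is in the image of the second differential, so that a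
    relation between its columns is proportional to the vector of generators of the ideal. *)
Lemma syzygy_ker (lam : 'I_(b 1) -> frac) : fin_row lam *m syzygy_mx = 0 ->
  forall c c', lam c * toF (f c') = lam c' * toF (f c).
Proof.
rewrite mul_fin_row => /rowP lam0 c c'.
have lamr r : \sum_c lam c * toF (diff 1 r c) = 0.
  by have := lam0 (enum_rank r); rewrite !mxE enum_rankK.
pose v : 'rV_(b 1) := f c' *: delta_mx 0 c - f c *: delta_mx 0 c'.
have [|w wE] := (diff_exact resC v).2.
  apply/rowP => j; rewrite mulmxBl -!scalemxAl -!rowE !mxE (col0E resC j).
  ring.
have : \sum_a lam a * toF (v 0 a) = 0.
  rewrite wE; under eq_bigr do rewrite mxE rmorph_sum mulr_sumr.
  rewrite exchange_big big1 // => r _ /=.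
  under eq_bigr do rewrite rmorphM mulrCA.
  by rewrite -mulr_sumr lamr mulr0.
under eq_bigr do rewrite !mxE rmorphB !rmorphM !rmorph_nat mulrBr !mulrA.
rewrite sumrB (bigD1 c) //= big1 ?addr0; last first.
  by move=> a /negbTE ac; rewrite ac mulr0.
rewrite (bigD1 c') //= [X in _ - (_ + X)]big1 ?addr0; last first.
  by move=> a /negbTE ac; rewrite ac mulr0.
by rewrite !eqxx !mulr1 => /eqP; rewrite subr_eq0 => /eqP.
Qed.

(** By [syzygy_ker] the relations between the columns form a line. *)
Lemma rank_syzygy : (b 1 <= (\rank syzygy_mx).+1)%N.
Proof.
have [b0|b_gt0] := leqP (b 1) 0; first exact: leq_trans b0 _.
pose c0 : 'I_(b 1) := Ordinal b_gt0.
have le : (\rank (kermx syzygy_mx) <= 1)%N.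
  apply: leq_trans (rank_leq_row (fin_row (fun c => toF (f c)))).
  apply: mxrankS; apply/rV_subP => w /sub_kermxP; rewrite [w]fin_rowE => /syzygy_ker H.
  apply/sub_rVP; exists (w 0 (enum_rank c0) / toF (f c0)).
  apply/rowP => j; rewrite !mxE; move: (H (enum_val j) c0) => E.
  have f0 : toF (f c0) != 0 by rewrite tofrac_eq0 generator_neq0.
  by rewrite mulrAC -E mulfK.
by move: le; rewrite mxrank_ker leq_subLR addn1 [X in (X <= _)%N]card_ord.
Qed.

(** Otherwise the second differential is injective by [rank_syzygy], so that F_3 and all
    later modules vanish. *)
Lemma betti_le : b 5 <> 0%N -> (b 1 <= b 2)%N.
Proof.
move=> b5; rewrite leqNgt; apply/negP => lt; apply: b5.
apply/betti_eq0/betti_eq0; apply/eqP; rewrite -leqn0 leqNgt; apply/negP => b3.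
pose c := Ordinal b3; have := basis_not_cycle c.
set v := _ *m _ => v0.
have v1 : v *m diff 1 = 0 by apply/(diff_exact resC); exists (delta_mx 0 c).
have free : row_free syzygy_mx^T.
  rewrite /row_free mxrank_tr eqn_leq rank_leq_col [X in (X <= _)%N]card_ord /=.
  by rewrite -ltnS (leq_trans lt) // rank_syzygy.
move/eqP: v0; apply; apply/rowP => r; rewrite [RHS]mxE; apply/eqP.
rewrite -tofrac_eq0.
have : fin_row (fun r => toF (v 0 r)) *m syzygy_mx^T = 0.
  rewrite tr_fin_mx mul_fin_row; apply/rowP => j; rewrite !mxE.
  have := congr1 (fun u : 'rV_(b 1) => toF (u 0 (enum_val j))) v1.
  rewrite !mxE rmorph0 rmorph_sum => {2}<-; apply: eq_bigr => a _.
  by rewrite rmorphM.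
move/eqP; rewrite mulmx_free_eq0 // => /eqP/rowP/(_ (enum_rank r)).
by rewrite !mxE enum_rankK => ->.
Qed.

(** Columns of degree above t that omit the column c0 are independent, since by [syzygy_ker]
    a relation that vanishes at c0 is zero. Their nonzero entries lie in rows of degree
    above t. *)
Lemma card_twist_gt t (c0 : 'I_(b 1)) : (twist c0 <= t)%N ->
  (#|[pred c : 'I_(b 1) | (t < twist c)%N]| <= #|[pred r : 'I_(b 2) | (t < twist r)%N]|)%N.
Proof.
move=> c0t.
pose J : pred 'I_(b 1) := fun c => (t < twist c)%N.
pose P : pred 'I_(b 2) := fun r => (t < twist r)%N.
rewrite -[X in (X <= _)%N]/#|J| -[X in (_ <= X)%N]/#|P|.
have E : coord_mx _ J *m syzygy_mx = coord_mx _ J *m syzygy_mx *m coord_mx _ P.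
  rewrite mul_coord_fin_mx mul_fin_mx_coord; apply: eq_fin_mx => c r.
  have [tc|] := boolP (J c); last by rewrite !mul0r.
  rewrite !mul1r; have [->|nz] := eqVneq (diff 1 r c) 0; first by rewrite rmorph0 mul0r.
  have -> : P r; last by rewrite mulr1.
  case ms : (msupp (diff 1 r c)) => [|mu s].
    by move: nz; rewrite -msupp_eq0 ms eqxx.
  have := @diff_homog _ _ _ _ resC 1 r c mu; rewrite ms mem_head => /(_ isT).
  by rewrite /P => <-; exact: ltn_addl.
have capJ : (coord_mx frac J :&: kermx syzygy_mx)%MS = 0.
  apply/eqP; rewrite -submx0; apply/rV_subP => w; rewrite [w]fin_rowE sub_capmx.
  move=> /andP[/fin_row_sub_coord wJ /sub_kermxP/syzygy_ker H].
  rewrite submx0; apply/eqP/rowP => j; rewrite !mxE enum_valK.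
  have := H (enum_val j) c0; rewrite enum_valK (wJ c0) ?mul0r; last by rewrite /J -leqNgt.
  by move/eqP; rewrite mulf_eq0 tofrac_eq0 (negbTE (generator_neq0 c0)) orbF => /eqP.
rewrite -(rank_coord frac J) -(mxrank_mul_ker _ syzygy_mx) capJ mxrank0 addn0 E.
by apply: leq_trans (mxrankM_maxr _ _) _; rewrite rank_coord.
Qed.

End Ranks.

(** * Comparison of syzygy degrees and two test polynomials *)
(** If every first syzygy has degree above t then so does every second syzygy, since its row
    in the minimal differential is nonzero. *)
Lemma card_twist_gt_all (k : fieldType) m (d : 'I_m -> nat) (C : free_sequence k m) t :
  is_minimal_graded_resolution d C -> (betti C 1 <= betti C 2)%N ->
  (#|[pred c : 'I_(betti C 1) | (t < twist c)%N]| <=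
   #|[pred r : 'I_(betti C 2) | (t < twist r)%N]|)%N.
Proof.
move=> resC b12.
have [/existsP[c0 c0t]|] := boolP [exists c : 'I_(betti C 1), (twist c <= t)%N].
  exact: card_twist_gt resC _ _ c0t.
rewrite negb_exists => /forallP all_gt.
apply: leq_trans (max_card _) _; rewrite card_ord (leq_trans b12) //.
rewrite -[X in (X <= _)%N]card_ord; apply: subset_leq_card; apply/fintype.subsetP => r _.
rewrite inE; have := basis_not_cycle resC r; apply: contraR; rewrite -leqNgt => rt.
apply/eqP/rowP => c; rewrite -rowE [RHS]mxE mxE.
apply: msuppnil0; case ms : (msupp _) => [//|mu s].
have := @diff_homog _ _ _ _ resC 1 r c mu; rewrite ms mem_head => /(_ isT) E.
by have := all_gt c; rewrite (leq_trans _ rt) // -E leq_addl.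
Qed.

(** Layer-cake summation: H (a c) is H 0 plus the increments of H below a c. *)
Lemma sum_le_of_card_gt (R : realDomainType) (p q : nat) (a : 'I_p -> nat)
    (b : 'I_q -> nat) (H : nat -> R) :
  (p <= q)%N -> (forall t, (#|[pred c | (t < a c)%N]| <= #|[pred c | (t < b c)%N]|)%N) ->
  0 <= H 0%N -> (forall n, H n <= H n.+1) -> \sum_c H (a c) <= \sum_c H (b c).
Proof.
move=> pq card_le H0 Hmon.
pose N := (\max_c a c + \max_c b c)%N.
have HE n : (n <= N)%N -> H n = H 0%N + \sum_(t < N) (H t.+1 - H t) *+ (t < n)%N.
  move=> nN; rewrite -(big_mkord xpredT (fun t => (H t.+1 - H t) *+ (t < n)%N)).
  rewrite (big_cat_nat _ nN) //= [X in _ + (_ + X)]big_nat_cond [X in _ + (_ + X)]big1 ?addr0.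
    rewrite (@eq_big_nat _ _ _ _ _ _ (fun t => H t.+1 - H t)) => [|t /andP[_ tn]].
      by rewrite telescope_sumr // addrC subrK.
    by rewrite tn.
  by move=> t /andP[/andP[nt _] _]; rewrite ltnNge nt.
have sumE (s : nat) (e : 'I_s -> nat) : (forall c, (e c <= N)%N) ->
    \sum_c H (e c) = H 0%N *+ s + \sum_(t < N) (H t.+1 - H t) *+ #|[pred c | (t < e c)%N]|.
  move=> eN; under eq_bigr do rewrite HE //.
  rewrite big_split /= sumr_const card_ord exchange_big /=; congr (_ + _).
  apply: eq_bigr => t _; rewrite -sumr_const big_mkcond /= [RHS]big_mkcond.
  by apply: eq_bigr => c _; rewrite inE; case: ifP.
rewrite (sumE _ a) => [|c]; last by apply: leq_trans (leq_addr _ _); exact: (leq_bigmax c).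
rewrite (sumE _ b) => [|c]; last by apply: leq_trans (leq_addl _ _); exact: (leq_bigmax c).
apply: lerD; first exact: ler_wpMn2l.
by apply: ler_sum => t _; apply: ler_wpMn2l => //; rewrite subr_ge0.
Qed.

Section Bounds.
Variable R : realFieldType.

(** The Chebyshev polynomial T_5 at 1 - 2t. Scaled to a given leading coefficient, it has the
    least maximum on the interval from 0 to 1 among the odd polynomials of degree 5 in 1 - 2t. *)
Definition cheb_poly : {poly R} := Poly [:: 1; -50; 400; -1120; 1280; -512].
(** The primitive of 360 (t (1 - t) - 1/6)^2 with value -1 at 0. Among the primitives of
    c (t (1 - t) - s)^2 with value -1 at 0 and 1 at 1, the choice s = 1/6 has the largest
    leading coefficient. *)
Definition mono_poly : {poly R} := Poly [:: -1; 10; -60; 160; -180; 72].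

Lemma horner_cheb t : cheb_poly.[t] =
  1 - 50 * t + 400 * t ^+ 2 - 1120 * t ^+ 3 + 1280 * t ^+ 4 - 512 * t ^+ 5.
Proof. by rewrite horner_Poly /=; ring. Qed.

Lemma horner_mono t : mono_poly.[t] =
  - 1 + 10 * t - 60 * t ^+ 2 + 160 * t ^+ 3 - 180 * t ^+ 4 + 72 * t ^+ 5.
Proof. by rewrite horner_Poly /=; ring. Qed.

(** 1 - T_5 and 1 + T_5 are a linear factor times a square. *)
Lemma cheb_bound t : 0 <= t <= 1 -> - 1 <= cheb_poly.[t] <= 1.
Proof.
move=> /andP[t0 t1]; rewrite horner_cheb; set c := (X in _ <= X <= _).
have E1 : 1 - c = 2 * t * (4 * (1 - 2 * t) ^+ 2 + 2 * (1 - 2 * t) - 1) ^+ 2.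
  by rewrite /c; ring.
have E2 : 1 + c = 2 * (1 - t) * (4 * (1 - 2 * t) ^+ 2 - 2 * (1 - 2 * t) - 1) ^+ 2.
  by rewrite /c; ring.
have : 0 <= 1 - c by rewrite E1 mulr_ge0 ?sqr_ge0 // mulr_ge0.
have : 0 <= 1 + c by rewrite E2 mulr_ge0 ?sqr_ge0 // mulr_ge0 // subr_ge0.
by move=> *; apply/andP; split; lra.
Qed.

(** With midpoint c, half-length e and q = c (1 - c) - 1/6, the integral of
    360 (q + (1 - 2c) s - s^2)^2 over s from - e to e is a sum of squares times e. *)
Lemma mono_poly_mono s t : s <= t -> mono_poly.[s] <= mono_poly.[t].
Proof.
move=> st; rewrite -subr_ge0 !horner_mono.
pose c := (s + t) / 2; pose e := (t - s) / 2.
have -> : s = c - e by rewrite /c /e; field.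
have -> : t = c + e by rewrite /c /e; field.
have e0 : 0 <= e by rewrite /e; lra.
pose q := c - c ^+ 2 - 1 / 6.
set L := (X in 0 <= X).
have -> : L = 720 * e * ((q - e ^+ 2 / 3) ^+ 2 + (1 - 2 * c) ^+ 2 * e ^+ 2 / 3 + 4 / 45 * e ^+ 4).
  by rewrite /L /q; field.
apply: mulr_ge0; first by rewrite mulr_ge0.
have := sqr_ge0 (q - e ^+ 2 / 3); have := sqr_ge0 ((1 - 2 * c) * e).
have := sqr_ge0 (e ^+ 2); rewrite -exprM exprMn; lra.
Qed.

End Bounds.

(** * Two upper bounds on the product of the generators *)
Section SyzygyBounds.
Variables (k : fieldType) (R : realFieldType) (d : 'I_6 -> nat) (C : free_sequence k 6).
Hypothesis resC : is_minimal_graded_resolution d C.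
Variables (F : int) (g : nat).
Hypothesis frob : is_Frobenius_number d F.
Hypothesis gE : g%:Z = F + (weight d setT)%:Z.
Hypothesis sym : forall n : int, (in_semigroup d n /\ ~ in_semigroup d (F - n)) \/
  (~ in_semigroup d n /\ in_semigroup d (F - n)).
Hypothesis g_gt0 : (0 < g)%N.
Local Notation beta i := ((betti C i)%:R : R).
Local Notation prod_d := (\prod_i (d i)%:R : R).

(** It is dual to the only basis element of F_0, in degree 0. *)
Lemma top_twist : exists c : 'I_(betti C 5), twist c = g.
Proof.
have := twist_count_dual resC gE sym (i := 5) (p := 0) erefl (leq0n g).
rewrite subn0 (twist_count0 resC) eqxx /twist_count => T5.
have /card_gt0P[c] : (0 < #|[pred c : 'I_(betti C 5) | twist c == g]|)%N by rewrite T5.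
by rewrite inE => /eqP; exists c.
Qed.

Lemma betti5_neq0 : betti C 5 <> 0%N.
Proof. by have [c _] := top_twist; have := ltn_ord c => + c0; rewrite {2}c0. Qed.

Lemma betti1_gt0 : (0 < betti C 1)%N.
Proof.
rewrite lt0n; apply/eqP => b1; apply: betti5_neq0.
by do 4 ! apply: (betti_eq0 resC).
Qed.

Lemma betti_le12 : (betti C 1 <= betti C 2)%N.
Proof. exact: betti_le resC betti5_neq0. Qed.

(** [resolution_moment] for the polynomial p(t / g). *)
Lemma scaled_moment (p : {poly R}) : (size p <= 6)%N ->
  (forall t, p.[1 - t] = - p.[t]) ->
  (p.[0] - \sum_c p.[(@twist _ _ C 1 c)%:R / g%:R] +
     \sum_c p.[(@twist _ _ C 2 c)%:R / g%:R]) * g%:R ^+ 5 = - (60 * prod_d * p`_5).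
Proof.
move=> sz anti; have g0 : g%:R != 0 :> R by rewrite pnatr_eq0 -lt0n.
pose psi : {poly R} := \poly_(i < 6) (p`_i / g%:R ^+ i).
have psiE t : psi.[t] = p.[t / g%:R].
  rewrite horner_poly (horner_coef_wide _ sz); apply: eq_bigr => i _.
  by rewrite expr_div_n mulrAC mulrA.
have := @resolution_moment _ _ _ resC _ _ frob gE sym R psi (size_poly _ _).
have psi_anti t : psi.[g%:R - t] = - psi.[t].
  by rewrite !psiE mulrBl divff // anti.
move=> /(_ psi_anti).
have sumE i : \sum_c psi.[(@twist _ _ C i c)%:R] = \sum_c p.[(@twist _ _ C i c)%:R / g%:R].
  by apply: eq_bigr => c _; rewrite psiE.
rewrite psiE mul0r !sumE coef_poly /= => E.
have : 2 * (p.[0] - \sum_c p.[(@twist _ _ C 1 c)%:R / g%:R] +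
     \sum_c p.[(@twist _ _ C 2 c)%:R / g%:R]) * g%:R ^+ 5 = 2 * - (60 * prod_d * p`_5).
  by rewrite E; field.
by rewrite -mulrA => /mulfI; apply; rewrite pnatr_eq0.
Qed.

Lemma sum1_betti i : beta i = \sum_(c < betti C i) 1.
Proof. by rewrite sumr_const card_ord. Qed.

(** Each of the 1 + beta_1 + beta_2 terms of [scaled_moment] is at most 1. *)
Lemma chebyshev_bound : 60 * 512 * prod_d <= (1 + beta 1 + beta 2) * g%:R ^+ 5.
Proof.
have szp : (size (cheb_poly R) <= 6)%N by exact: size_Poly.
have anti t : (cheb_poly R).[1 - t] = - (cheb_poly R).[t].
  by rewrite !horner_cheb; ring.
have := scaled_moment szp anti.
have -> : (cheb_poly R)`_5 = -512 by rewrite coef_Poly.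
set X := \sum_c _; set Y := \sum_c _; rewrite horner_cheb => E.
have g0 : 0 < g%:R :> R by rewrite ltr0n.
have in01 i (c : 'I_(betti C i)) : 0 <= ((twist c)%:R / g%:R : R) <= 1.
  rewrite divr_ge0 ?ler0n //= ler_pdivrMr // mul1r ler_nat.
  exact: (twist_le resC frob gE).
have XL : - beta 1 <= X.
  rewrite sum1_betti -sumrN.
  by apply: ler_sum => c _; case/andP: (cheb_bound (in01 1%N c)).
have YL : Y <= beta 2.
  by rewrite sum1_betti; apply: ler_sum => c _; case/andP: (cheb_bound (in01 2%N c)).
have -> : 60 * 512 * prod_d = (1 - X + Y) * g%:R ^+ 5.
  transitivity (- (60 * prod_d * -512)); first by ring.
  by rewrite -E; ring.
rewrite ler_pM2r ?exprn_gt0 //; lra.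
Qed.

(** The values of [mono_poly] plus 1 are nonnegative and increasing, so that their sum over
    the second syzygies is at least that over the first ones. *)
Lemma monotone_bound : 60 * 72 * prod_d <= (beta 2 - beta 1 + 1) * g%:R ^+ 5.
Proof.
have szp : (size (mono_poly R) <= 6)%N by exact: size_Poly.
have anti t : (mono_poly R).[1 - t] = - (mono_poly R).[t].
  by rewrite !horner_mono; ring.
have := scaled_moment szp anti.
have -> : (mono_poly R)`_5 = 72 by rewrite coef_Poly.
set X := \sum_c _; set Y := \sum_c _; rewrite horner_mono => E.
have g0 : 0 < g%:R :> R by rewrite ltr0n.
have XY : X + beta 1 <= Y + beta 2.
  rewrite !sum1_betti -!big_split /=.
  apply: (sum_le_of_card_gt (H := fun n => (mono_poly R).[n%:R / g%:R] + 1)) => [|t||n].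
  - exact: betti_le12.
  - exact: card_twist_gt_all resC betti_le12.
  - rewrite horner_mono mul0r; lra.
  by rewrite lerD2r mono_poly_mono // ler_pM2r ?invr_gt0 // ler_nat.
have -> : 60 * 72 * prod_d = (1 + X - Y) * g%:R ^+ 5.
  transitivity (- (- (60 * prod_d * 72))); first by ring.
  by rewrite -E; ring.
rewrite ler_pM2r ?exprn_gt0 //; lra.
Qed.

End SyzygyBounds.

(** * The maximizer of G *)
Section Maximizer.
Variable R : realType.
Implicit Types (b u v w : R).

(** The cubic is positive at 0 and 1 and negative at 1/2. *)
Lemma cubic_roots b : 0 < b -> exists u w,
  [/\ 0 < u < 1 / 2, 1 / 2 < w, cubic b u = 0 & cubic b w = 0].
Proof.
move=> b0; pose p : {poly R} := Poly [:: b; - (9 * b); 2 * (5 * b - 3); 8].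
have pE v : p.[v] = cubic b v by rewrite horner_Poly /= /cubic; ring.
have c0 : cubic b 0 = b by rewrite /cubic; ring.
have c12 : cubic b (1 / 2) = - (b + 1 / 2) by rewrite /cubic; field.
have c1 : cubic b 1 = 2 + 2 * b by rewrite /cubic; ring.
have [||u /andP[u0 u1] /rootP] := @poly_ivt _ (- p) 0 (1 / 2); first by lra.
  by rewrite !hornerN !pE c0 c12; apply/andP; split; lra.
rewrite hornerN pE => /eqP; rewrite oppr_eq0 => /eqP cu.
have [||w /andP[w0 w1] /rootP] := @poly_ivt _ p (1 / 2) 1; first by lra.
  by rewrite !pE c1 c12; apply/andP; split; lra.
rewrite pE => cw; exists u, w; split => //.
  apply/andP; split; rewrite lt_neqAle ?u0 ?u1 andbT; apply/eqP => E.
    by move: cu; rewrite -E c0; lra.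
  by move: cu; rewrite E c12; lra.
rewrite lt_neqAle w0 andbT; apply/eqP => E.
by move: cw; rewrite -E c12; lra.
Qed.

(** Two divided differences. *)
Lemma cubic_factor b u w v : u != w -> cubic b u = 0 -> cubic b w = 0 ->
  cubic b v = (v - u) * (v - w) * (8 * (v + u + w) + 2 * (5 * b - 3)).
Proof.
move=> uw cu cw.
(* The divided difference of the cubic at u. *)
pose D x := 8 * (x ^+ 2 + u * x + u ^+ 2) + 2 * (5 * b - 3) * (x + u) - 9 * b.
have Dw : D w = 0.
  apply: (mulfI (_ : w - u != 0)); first by rewrite subr_eq0 eq_sym.
  have -> : (w - u) * D w = cubic b w - cubic b u by rewrite /cubic /D; ring.
  by rewrite cu cw subrr mulr0.
have -> : cubic b v = cubic b u + (v - u) * D w +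
    (v - u) * (v - w) * (8 * (v + u + w) + 2 * (5 * b - 3)).
  by rewrite /cubic /D; ring.
by rewrite cu Dw mulr0 !add0r.
Qed.

(** The third factor of [cubic_factor] is positive at 0 since the value b of the cubic is,
    and it increases. *)
Lemma smaller_root b u w : 0 < b -> 0 < u -> u < w -> cubic b u = 0 -> cubic b w = 0 ->
  is_smaller_positive_root (cubic b) u.
Proof.
move=> b0 u0 uw cu cw; split=> //; exists w => // v v0.
have unw : u != w by rewrite lt_eqF.
have E x := cubic_factor x unw cu cw.
split=> [|[]->//]; rewrite E => /eqP; rewrite !mulf_eq0 !subr_eq0.
case/orP => [/orP[/eqP|/eqP]|/eqP e0]; [by left|by right|].
have := E 0; rewrite /cubic !expr0n /= !mulr0 subr0 !add0r => b_eq.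
have : 0 < 8 * (u + w) + 2 * (5 * b - 3).
  rewrite -(pmulr_rgt0 _ (mulr_gt0 u0 (lt_trans u0 uw))).
  suff -> : u * w * (8 * (u + w) + 2 * (5 * b - 3)) = b by [].
  by rewrite [RHS]b_eq; ring.
lra.
Qed.

Lemma G_gt0 b u : 0 < b -> 0 < u < 1 / 2 -> 0 < G b u.
Proof.
move=> b0 /andP[u0 u1].
have p1 : 0 < 1 - u by lra.
have p2 : 0 < 1 - 2 * u by lra.
rewrite /G; apply: mulr_gt0; last exact: exprn_gt0.
apply: mulr_gt0; last exact: exprn_gt0.
by rewrite divr_gt0 // addr_gt0.
Qed.

(** Write G(b, v) / G(b, u) as (1 + x1) (1 + x2)^2 (1 + x3)^2. The inequality 1 + x <= exp x
    bounds it by the exponential of x1 + 2 x2 + 2 x3. The vanishing of the cubic at u says that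
    the logarithmic derivative of G(b, .) is zero at u, which cancels the part of this exponent
    that is linear in v - u. *)
Lemma cubic_root_maximizes b u : 0 < b -> 0 < u < 1 / 2 -> cubic b u = 0 ->
  is_the_maximizer (G b) u.
Proof.
move=> b0 u01 cu; split=> // v /andP[v0 v1] vu; case/andP: (u01) => u0 u1.
pose x1 := b * (v - u) / (u * (v + b)).
pose x2 := - (v - u) / (1 - u).
pose x3 := - 2 * (v - u) / (1 - 2 * u).
have nz : [/\ u != 0, u + b != 0, v + b != 0, 1 - u != 0 & 1 - 2 * u != 0].
  by split; rewrite gt_eqF //; lra.
case: nz => n1 n2 n3 n4 n5.
have GE : G b v = G b u * ((1 + x1) * (1 + x2) ^+ 2 * (1 + x3) ^+ 2).
  rewrite /G /x1 /x2 /x3; field.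
  by rewrite n1 n2 n3 n4 n5.
have sumx : x1 + (x2 + x2) + (x3 + x3) = - ((v - u) ^+ 2 * b / (u * (v + b) * (u + b))).
  apply/eqP; rewrite -subr_eq0; apply/eqP.
  rewrite (_ : _ - _ = (v - u) * cubic b u / (u * (u + b) * (1 - u) * (1 - 2 * u))).
    by rewrite cu mulr0 mul0r.
  rewrite /x1 /x2 /x3 /cubic; field.
  by rewrite n1 n2 n3 n4 n5.
have lt1 : (1 + x1) * (1 + x2) ^+ 2 * (1 + x3) ^+ 2 < 1.
  have p1 : 0 <= 1 + x1.
    have -> : 1 + x1 = v * (u + b) / (u * (v + b)) by rewrite /x1; field; rewrite n1 n3.
    by apply: ltW; rewrite divr_gt0 ?mulr_gt0 //; lra.
  have p2 : 0 <= 1 + x2.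
    have -> : 1 + x2 = (1 - v) / (1 - u) by rewrite /x2; field.
    by apply: ltW; rewrite divr_gt0 //; lra.
  have p3 : 0 <= 1 + x3.
    have -> : 1 + x3 = (1 - 2 * v) / (1 - 2 * u) by rewrite /x3; field.
    by apply: ltW; rewrite divr_gt0 //; lra.
  apply: (@le_lt_trans _ _ (expR (x1 + (x2 + x2) + (x3 + x3)))).
    have sq x : 0 <= 1 + x -> (1 + x) ^+ 2 <= expR (x + x).
      by move=> x0; rewrite expRD -expr2 lerXn2r ?nnegrE ?expR_ge0 ?expR_ge1Dx.
    rewrite [X in _ <= X]expRD [expR (x1 + _)]expRD.
    apply: ler_pM; rewrite ?sq ?mulr_ge0 ?exprn_ge0 //.
    by apply: ler_pM; rewrite ?sq ?exprn_ge0 ?expR_ge1Dx.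
  rewrite expR_lt1 sumx oppr_lt0; apply: divr_gt0.
    by apply: mulr_gt0 => //; rewrite exprn_even_gt0 //= subr_eq0.
  by do 2 ? [apply: mulr_gt0 => //]; rewrite addr_gt0.
by rewrite GE -[X in _ < X]mulr1 ltr_pM2l // G_gt0.
Qed.

End Maximizer.

(** * The lower bound on the largest syzygy degree *)
(** Only the value of G at 1/10 is used. It is a constant over b + 1/10, and the constants
    are rounded down. *)
Lemma K_lower_bound (R : realType) (b um : R) : 0 < b ->
  is_the_maximizer (G b) um ->
  1 / 16 + 6 / 125 / (b + 1 / 10) < K b (9682 / 10000) um.
Proof.
move=> b0 [_ um_max].
have Gum : G b (1 / 10) <= G b um.
  have [->//|ne] := eqVneq (1 / 10) um.
  by apply/ltW/um_max => //; apply/andP; split; lra.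
have G10 : G b (1 / 10) = 324 / 6250 / (b + 1 / 10).
  by rewrite /G; field; rewrite gt_eqF //; lra.
have y0 : 0 < (b + 1 / 10)^-1 by rewrite invr_gt0; lra.
rewrite /K; rewrite G10 in Gum; move: (_^-1) y0 Gum => y y0 Gum; nra.
Qed.

(** Here x is the product of the generators over the fifth power of the degree. With
    y = 1 / (b + 1/10), the case b <= 1/5 has y >= 10/3, and the other one has
    1 / b <= (3/2) y. *)
Lemma compare_bounds (R : realType) (b1 B x K5 : R) : 0 < b1 -> 0 < B ->
  60 * 512 * x <= 2 * (b1 + B) -> 60 * 72 * x <= 2 * B ->
  1 / 16 + 6 / 125 / (B / b1 + 1 / 10) < K5 -> 360 * x < B * K5.
Proof.
move=> b10 B0 h1 h2 hK.
have b0 : 0 < B / b1 by rewrite divr_gt0.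
set b := B / b1 in hK b0; have BE : B = b * b1 by rewrite /b divfK // gt_eqF.
pose y := (b + 1 / 10)^-1.
have yE : y * (b + 1 / 10) = 1 by rewrite mulVf // gt_eqF //; lra.
have y0 : 0 < y by rewrite invr_gt0; lra.
have K1 : B * (1 / 16 + 6 / 125 * y) < B * K5 by rewrite ltr_pM2l.
apply: le_lt_trans K1.
have [small|large] := leP b (1 / 5).
  have : 10 / 3 <= y by nra.
  move=> y3; have : B * (10 / 3) <= B * y by rewrite ler_pM2l.
  nra.
have : b1 <= B * (3 / 2) * y.
  have -> : b1 = b1 * (y * (b + 1 / 10)) by rewrite yE mulr1.
  have : 0 < b1 * y by rewrite mulr_gt0.
  rewrite BE; nra.
nra.
Qed.

Lemma fifth_root_lt (R : realType) (x y g : R) : 0 <= x -> 0 <= y -> 0 < g ->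
  x * y < g ^+ 5 -> fifth_root x * fifth_root y < g.
Proof.
move=> x0 y0 g0 xy; rewrite /fifth_root -powRM //.
have -> : g = (g ^+ 5) `^ (1 / 5).
  by rewrite -powR_mulrn ?ltW // -powRrM mulrC divfK ?powRr1 ?ltW // pnatr_eq0.
apply: gt0_ltr_powR => //; first by rewrite divr_gt0.
  by rewrite nnegrE mulr_ge0.
by rewrite nnegrE exprn_ge0 // ltW.
Qed.

Theorem theorem1 (k : fieldType) (R : realType) (d : 'I_6 -> nat)
    (C : free_sequence k 6) (g : nat) :
  minimal_generators d ->
  symmetric_semigroup d ->
  is_minimal_graded_resolution d C ->
  ~ complete_intersection C ->
  is_largest_syzygy_degree C g ->
  let beta1 : R := (betti C 1)%:R in
  let beta2 : R := (betti C 2)%:R in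
  let pi6 : R := \prod_(j < 6) (d j)%:R in
  let B6 : R := (beta2 - beta1 + 1) / 2 in
  let b : R := B6 / beta1 in
  let Astar : R := 9682 / 10000 in
  exists um : R,
    [/\ is_the_maximizer (G b) um,
        is_smaller_positive_root (cubic b) um
      & let lambda6 := fifth_root (360 / (B6 * K b Astar um)) in
        let g6 := lambda6 * fifth_root pi6 in
        g6 < g%:R].
Proof.
move=> [d_gt0 _ _ _] [F frob sym] resC _ [_ g_max] beta1 beta2 pi6 B6 b Astar.
(* Otherwise -1 would lie above F, and so in the semigroup. *)
have F_ge : -1 <= F.
  rewrite leNgt; apply/negP => /frob.2; case=> s _; lia.
have sum_ge : (6 <= weight d [set: 'I_6])%N.
  rewrite -[X in (X <= _)%N](card_ord 6) -cardsT -sum1_card /weight.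
  by apply: leq_sum => i _.
pose g0 := absz (F + (weight d [set: 'I_6])%:Z).
have g0E : g0%:Z = F + (weight d [set: 'I_6])%:Z by rewrite /g0; lia.
have g0_gt0 : (0 < g0)%N by lia.
have [c cE] := top_twist resC g0E sym.
have g0g : (g0 <= g)%N by rewrite -cE; exact: g_max.
have cheb := chebyshev_bound R resC frob g0E sym g0_gt0.
have mono := monotone_bound R resC frob g0E sym g0_gt0.
have b1_gt0 : 0 < beta1.
  by rewrite ltr0n; exact: (betti1_gt0 resC g0E sym).
have b12 : beta1 <= beta2.
  by rewrite ler_nat; exact: (betti_le12 resC g0E sym).
have B_gt0 : 0 < B6 by rewrite /B6; lra.
have b_gt0 : 0 < b by rewrite divr_gt0.
have [u [w [u01 w0 cu cw]]] := cubic_roots b_gt0.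
have umax := cubic_root_maximizes b_gt0 u01 cu.
exists u; split=> //.
  case/andP: u01 => u0 u1; exact: smaller_root b_gt0 u0 (lt_trans u1 w0) cu cw.
have pi0 : 0 < pi6 by apply: prodr_gt0 => i _; rewrite ltr0n.
have gg : (g0%:R : R) ^+ 5 <= g%:R ^+ 5 by rewrite lerXn2r ?nnegrE ?ler0n // ler_nat.
have g5 : 0 < (g%:R : R) ^+ 5 by rewrite exprn_gt0 // ltr0n (leq_trans g0_gt0).
have Klow := K_lower_bound b_gt0 umax.
have K_gt0 : 0 < K b Astar u.
  apply: lt_trans Klow; rewrite addr_gt0 ?divr_gt0 ?addr_gt0 //; lra.
have BK_gt0 : 0 < B6 * K b Astar u by exact: mulr_gt0.
apply: fifth_root_lt; [|exact: ltW|by rewrite ltr0n (leq_trans g0_gt0)|].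
  by apply/ltW/divr_gt0.
rewrite mulrAC ltr_pdivrMr //.
have : 360 * (pi6 / g%:R ^+ 5) < B6 * K b Astar u.
  apply: (@compare_bounds _ beta1) => //.
  - rewrite mulrA ler_pdivrMr //.
    have -> : 2 * (beta1 + B6) = 1 + beta1 + beta2 by rewrite /B6; field.
    apply: le_trans cheb _; rewrite ler_pM2l //; lra.
  - rewrite mulrA ler_pdivrMr //.
    have -> : 2 * B6 = beta2 - beta1 + 1 by rewrite /B6; field.
    apply: le_trans mono _; rewrite ler_pM2l //; lra.
by rewrite mulrA ltr_pdivrMr // [X in _ < X]mulrC; rewrite [360 * _]mulrC.
Qed.
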